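(* Let $1\le r<\infty$ and let $\mathscr B$ be a (separable) doubling ball-basis in a measure space $(X,\mu)$. If a family of bounded oscillation operators $\{T_\alpha\}$, $T_\alpha:L^r(X,\mathbb U)\to L^0(X,\mathbb V)$, satisfies conditions (R2)–(R5) and the corresponding maximal operator $Tf=\sup_\alpha\|T_\alpha(f)\|_{\mathbb V}$ satisfies $\mathcal L_0(T)+\sup_\alpha\mathcal L_1(T_\alpha)<\infty$, then the bound $$\mathrm{OSC}_{B,\beta}\,T(f)\lesssim\Big(\mathcal L_0(T)(1-\beta)^{-1/r}+\sup_\alpha\mathcal L_1(T_\alpha)\Big)\langle f\rangle^*_{\#,B}$$ holds for any $f\in L^r(X,\mathbb U)$, any ball $B\in\mathscr B$ and any number $0<\beta<1$.
   Context: Ball-basis. Let $(X,\mathfrak M,\mu)$ be a measure space. A family $\mathscr B$ of measurable sets (balls) is a ball-basis if: (B1) $0<\mu(B)<\infty$ for $B\in\mathscr B$; (B2) any two points lie in a common ball; (B3) for any $E\in\mathfrak M$, $\varepsilon>0$ there is a finite or infinite sequence of balls $B_k$ with $\mu(E\triangle\bigcup_kB_k)<\varepsilon$; (B4) for any $B\in\mathscr B$ there is a ball $[B]\in\mathscr B$ with $B^*:=\bigcup_{A\in\mathscr B:\ \mu(A)\le2\mu(B),\ A\cap B\ne\varnothing}A\subset[B]$ and $\mu([B])\le\mathcal K\mu(B)$, $\mathcal K$ independent of $B$. All ball-bases are assumed separable (arbitrary unions of balls are measurable). $\mathscr B$ is doubling if there is $\eta>1$ such that for every ball $B$ with $B^*\ne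 X$ there is a ball $B'\supsetneq B$ with $\mu(B')\le\eta\mu(B)$. Notation. $\mathbb U,\mathbb V$ are Banach spaces; $L^0(X,\mathbb V)$ is the space of measurable $\mathbb V$-valued functions. $\langle f\rangle_A=\big(\frac1{\mu(A)}\int_A\|f\|_{\mathbb U}^r\big)^{1/r}$, $\langle f\rangle_A^*=\sup_{C\in\mathscr B,C\supset A}\langle f\rangle_C$, $f_B=\frac1{\mu(B)}\int_Bf$, $\langle f\rangle_{\#,B}=\big(\frac1{\mu(B)}\int_B\|f-f_B\|_{\mathbb U}^r\big)^{1/r}$, $\langle f\rangle^*_{\#,B}=\sup_{A\in\mathscr B,A\supset B}\langle f\rangle_{\#,A}$. $\mathrm{OSC}_E(g)=\operatorname{esssup}_{x,x'\in E}\|g(x)-g(x')\|$, $\mathrm{SUP}_E(g)=\operatorname{esssup}_{x\in E}\|g(x)\|$ (norm of the space of values), and $\mathrm{OSC}_{B,\beta}(g)=\inf_{E\subset B:\,\mu(E)>\beta\mu(B)}\mathrm{OSC}_E(g)$. BO operators (with parameters $\varrho=\rho=1/r$). A sublinear $S:L^r(X,\mathbb U)\to L^0(X,\mathbb V)$ (i.e. $\|S(f+g)\|_{\mathbb V}\le\|Sf\|_{\mathbb V}+\|Sg\|_{\mathbb V}$) is a bounded oscillation (BO) operator if there are constants $\mathcal L_j(S)$ such that, whenever $f\in L^r(X,\mathbb U)$: (T0) for $B\in\mathscr B$, $\lambda>0$: $\mu\{x\in B:\|S(f\mathbf 1_B)(x)\|_{\mathbb V}>\lambda\langle f\rangle_B\}\le(\mathcal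 L_0/\lambda)^{r}\mu(B)$; (T1) for $B\in\mathscr B$: $\mathrm{OSC}_B(S(f\mathbf 1_{X\setminus B^*}))\le\mathcal L_1\langle f\rangle^*_B$; (T2) for every ball $A$ with $A^*\ne X$ there is a ball $B\supsetneq A$ with $\mathrm{SUP}_A(S(f\mathbf 1_{B^*\setminus A^*}))\le\mathcal L_2\langle f\rangle_{B^*}$. Conditions on an operator $S$: (R2) $S$ is linear; (R3) $S$ satisfies (T0) with $\varrho=\rho=1/r$; (R4) there is a constant $\mathcal L_1(S)$ such that for any ball $B$, $\mathrm{OSC}_B(S(f\mathbf 1_{X\setminus B^*}))\le\mathcal L_1(S)\sup_{A\in\mathscr B:A\supset B}\log^{-1}\big(1+\frac{\mu(A)}{\mu(B)}\big)\langle f\rangle_A$; (R5) for any ball $B$ and $\varepsilon>0$ there is a ball $B'\supset B$ such that for any ball $B''\supset B'$ it holds $\mathrm{OSC}_B(S(\mathbf 1_{B''}))\le\varepsilon$. In the claim $\mathcal L_1(T_\alpha)$ is the constant of (R4) and $\mathcal L_0(T)$ is the constant in (T0) for the maximal operator $T$. $a\lesssim b$ means $a\le c\,b$ with $c>0$ depending only on $\mathcal K,\eta,r$. *)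

(* Defs.v *)
From HB Require Import structures.
From mathcomp Require Import all_boot all_order all_algebra.
From mathcomp Require Import all_classical all_reals all_analysis. 
From mathcomp Require Import ess_sup_inf.

Set Implicit Arguments.
Unset Strict Implicit.
Unset Printing Implicit Defensive.
Import Order.TTheory GRing.Theory Num.Theory.
Import numFieldNormedType.Exports.

Local Open Scope classical_set_scope.
Local Open Scope ring_scope.

Section banach_valued_functions.
Context (d : measure_display) (X : measurableType d) (R : realType).
Context (mu : {measure set X -> \bar R}) (U : normedModType R).
Implicit Types (f s : X -> U) (A : set X) (r : R).

Definition simple_function s : Prop :=
  finite_set (range s) /\ forall u, measurable (s @^-1` [set u]).

(* Members of L^0(X, U).  Measurability of vector-valued functions is Bochner's
   (strong) one; U need not be separable. *)
Definition strongly_measurable f : Prop :=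
  exists2 s : nat -> X -> U, (forall n, simple_function (s n)) &
    forall x, s n x @[n --> \oo] --> f x.

(* Members of L^r(X, U), as functions: the identification of functions that
   agree almost everywhere is made in [operator] below. *)
Definition in_Lr r f : Prop :=
  strongly_measurable f /\ (\int[mu]_x (`|f x| `^ r)%:E < +oo)%E.

Definition cutoff A f : X -> U := fun x => \1_A x *: f x.

(* To be used only when mu A is finite, as [fine +oo = 0]. *)
Definition simple_integral A s : U :=
  \sum_(u \in range s) fine (mu (A `&` s @^-1` [set u])) *: u.

Definition is_bochner_integral A f (v : U) : Prop :=
  exists s : nat -> X -> U,
    [/\ forall n, simple_function (s n),
        (\int[mu]_(x in A) (`|s n x - f x|)%:E)%E @[n --> \oo] --> 0%E &
        simple_integral A (s n) @[n --> \oo] --> v].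

(* Equal to 0 if f is not Bochner integrable over A. *)
Definition bochner_integral A f : U := xget 0 (is_bochner_integral A f).

(* <f>_A *)
Definition mean_norm r f A : \bar R :=
  (((fine (mu A))^-1%:E * \int[mu]_(x in A) (`|f x| `^ r)%:E) `^ r^-1)%E.

(* f_A *)
Definition mean f A : U := (fine (mu A))^-1 *: bochner_integral A f.

(* <f>_{#,A} *)
Definition mean_osc r f A : \bar R := mean_norm r (fun x => f x - mean f A) A.

(* <f>^*_A *)
Definition mean_norm_sup (BB : set (set X)) r f A : \bar R :=
  ereal_sup [set mean_norm r f C | C in [set C | BB C /\ A `<=` C]].

(* <f>^*_{#,B} *)
Definition mean_osc_sup (BB : set (set X)) r f (B : set X) : \bar R :=
  ereal_sup [set mean_osc r f A | A in [set A | BB A /\ B `<=` A]].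

(* The essential supremum over the pairs (x, x') in E * E is that of [ess_sup],
   for the product of the filter of conull sets with itself. *)
Definition OSC (E : set X) f : \bar R :=
  ereal_inf [set c : \bar R |
    \forall x \near almost_everywhere mu & x' \near almost_everywhere mu,
      E x -> E x' -> ((`|f x - f x'|)%:E <= c)%E].

(* As the norm is nonnegative, extending it by 0 outside E does not change its
   essential supremum over E, provided that mu E > 0. *)
Definition SUP (E : set X) f : \bar R :=
  ess_sup mu (fun x => (`|cutoff E f x|)%:E).

Definition OSC_beta (beta : R) (B : set X) f : \bar R :=
  ereal_inf [set OSC E f | E in
    [set E | [/\ measurable E, E `<=` B & (beta%:E * mu B < mu E)%E]]].

End banach_valued_functions.

Section ball_basis.
Context (d : measure_display) (X : measurableType d) (R : realType).
Context (mu : {measure set X -> \bar R}) (BB : set (set X)).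

(* B^* *)
Definition hull (B : set X) : set X :=
  \bigcup_(A in [set A | [/\ BB A, (mu A <= 2%:E * mu B)%E &
                             A `&` B !=set0]]) A.

(* The sequences of (B3) are indexed by a set D of natural numbers, so as to
   allow both finite and infinite ones. *)
Record ball_basis (K : R) : Prop := BallBasis {
  ball_measurable : forall B, BB B -> measurable B;
  ball_B1 : forall B, BB B -> (0 < mu B < +oo)%E;
  ball_B2 : forall x y, exists B, [/\ BB B, B x & B y];
  ball_B3 : forall (E : set X) (eps : R), measurable E -> 0 < eps ->
    exists (D : set nat) (B : nat -> set X), (forall k, D k -> BB (B k)) /\
      (mu (E `+` \bigcup_(k in D) B k) < eps%:E)%E;
  ball_B4 : forall B, BB B -> exists B1,
    [/\ BB B1, hull B `<=` B1 & (mu B1 <= K%:E * mu B)%E]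
}.

Definition separable_basis : Prop :=
  forall F : set (set X), F `<=` BB -> measurable (\bigcup_(B in F) B).

Definition doubling_basis (eta : R) : Prop :=
  1 < eta /\ forall B, BB B -> hull B <> setT ->
    exists B', [/\ BB B', B `<` B' & (mu B' <= eta%:E * mu B)%E].

End ball_basis.

Section operators.
Context (d : measure_display) (X : measurableType d) (R : realType).
Context (mu : {measure set X -> \bar R}) (BB : set (set X)) (r : R).
Context (U V : normedModType R).
Implicit Types (S : (X -> U) -> X -> V) (f g : X -> U) (A B E : set X) (L : R).

(* S : L^r(X, U) -> L^0(X, V), where both sides are spaces of classes modulo
   almost everywhere equality. *)
Definition operator S : Prop :=
  (forall f, in_Lr mu r f -> strongly_measurable (S f)) /\
  (forall f g, in_Lr mu r f -> in_Lr mu r g ->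
    (\forall x \ae mu, f x = g x) -> \forall x \ae mu, S f x = S g x).

Definition sublinear S : Prop :=
  forall f g, in_Lr mu r f -> in_Lr mu r g ->
    \forall x \ae mu, `|S (f \+ g) x| <= `|S f x| + `|S g x|.

Definition T0 S L : Prop := 0 <= L /\
  forall f, in_Lr mu r f -> forall B, BB B -> forall lambda : R, 0 < lambda ->
    (mu (B `&` [set x | lambda%:E * mean_norm mu r f B < (`|S (cutoff B f) x|)%:E])
       <= ((L / lambda) `^ r)%:E * mu B)%E.

Definition T1 S L : Prop := 0 <= L /\
  forall f, in_Lr mu r f -> forall B, BB B ->
    (OSC mu B (S (cutoff (~` hull mu BB B) f))
       <= L%:E * mean_norm_sup mu BB r f B)%E.

Definition T2 S L : Prop := 0 <= L /\
  forall f, in_Lr mu r f -> forall A, BB A -> hull mu BB A <> setT ->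
    exists B, [/\ BB B, A `<` B &
      (SUP mu A (S (cutoff (hull mu BB B `\` hull mu BB A) f))
         <= L%:E * mean_norm mu r f (hull mu BB B))%E].

Definition BO_operator S : Prop :=
  [/\ operator S, sublinear S & exists L0 L1 L2, [/\ T0 S L0, T1 S L1 & T2 S L2]].

Definition R2 S : Prop :=
  forall (a : R) f g, in_Lr mu r f -> in_Lr mu r g ->
    \forall x \ae mu, S (fun y => a *: f y + g y) x = a *: S f x + S g x.

Definition R3 S : Prop := exists L, T0 S L.

Definition R4 S L : Prop := 0 <= L /\
  forall f, in_Lr mu r f -> forall B, BB B ->
    (OSC mu B (S (cutoff (~` hull mu BB B) f)) <=
     L%:E * ereal_sup [set (ln (1 + fine (mu A) / fine (mu B)))^-1%:E *
                           mean_norm mu r f A | A in [set A | BB A /\ B `<=` A]])%E.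

(* S acts on U-valued functions, so that the indicator of a ball is turned into
   one by a vector u.  For U = R, taking u = 1 is enough since S is linear. *)
Definition R5 S : Prop :=
  forall (u : U) B (eps : R), BB B -> 0 < eps ->
    exists B', [/\ BB B', B `<=` B' & forall B'', BB B'' -> B' `<=` B'' ->
      (OSC mu B (S (cutoff B'' (fun=> u))) <= eps%:E)%E].

(* The functions T_a f are only defined up to null sets, possibly depending on a,
   so that sup_a |T_a f| is the supremum in the lattice of classes of measurable
   functions, i.e., the least measurable majorant modulo null sets.  It is the
   class of the pointwise supremum if the family is countable. *)
Definition maximal_operator (I : Type) (Tf : I -> (X -> U) -> X -> V)
    (T : (X -> U) -> X -> R) : Prop :=
  forall f, in_Lr mu r f ->
    [/\ measurable_fun setT (T f),
        forall a, \forall x \ae mu, `|Tf a f x| <= T f x &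
        forall h : X -> R, measurable_fun setT h ->
          (forall a, \forall x \ae mu, `|Tf a f x| <= h x) ->
          \forall x \ae mu, T f x <= h x].

End operators.

(* Main.v *)
Require Import Defs.
From HB Require Import structures.
From mathcomp Require Import all_boot all_order all_algebra.
From mathcomp Require Import finmap.
From mathcomp Require Import all_classical all_reals all_analysis.
From mathcomp Require Import measurable_realfun lra ring.

Set Implicit Arguments.
Unset Strict Implicit.
Unset Printing Implicit Defensive.
Import Order.TTheory GRing.Theory Num.Theory.
Import numFieldNormedType.Exports.

Local Open Scope classical_set_scope.
Local Open Scope ring_scope.

(* Let u = f_B and split f = f1 + f2 with f1 = 1_{B^*} (f - u).  The weak type
   estimate (T0) for T on the ball [B] bounds T f1 off a subset of B of measure
   less than (1 - beta) mu(B), and |T f - T f2| <= T f1.  It remains to bound the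
   oscillation on B of each T_a f2, uniformly in a.  For a ball C (depending on
   a) containing [B],
     f2 = 1_{C \ B^*} (f - u) + 1_{X \ C} f + 1_C u.
   When C is large, the last term contributes little by (R5), and so does the
   second one as ||1_{X \ C} f||_r tends to 0.  For the first one, the logarithm
   in (R4) compensates the growth of the means,
     <f - u>_A <= c log(1 + mu(A) / mu(B)) <f>^*_{#,B}   for A containing B,
   which is obtained by joining B to A by a chain of balls whose measures grow
   geometrically. *)

(** * Strong measurability *)

(** When mu(X) is infinite and u is not 0, f - u is not in L^r, so T_a has no value at f - u or at
    its part outside B^*. The factor (1 - beta)^(-1/r) is the level at which the weak type estimate
    on [B] leaves an exceptional set of measure at most (1 - beta)/2 mu(B). The half makes the
    inequality mu(E) > beta mu(B) strict. The family may be uncountable and the null sets vary with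
    a, so nothing about T can be read off pointwise from the T_a. Both the comparison of T f with T
    f2 and the passage from the oscillations of the T_a f2 to that of T f2 go through the minimality
    of T among measurable majorants. *)

Section finitely_valued.
Context (d : measure_display) (X : measurableType d) (R : realType).

(** The body is that of [simple_function], for values in any type, and the two are used
    interchangeably. The generality serves for pairs of simple functions, whose level sets form a
    common partition. *)
Definition finitely_valued (W : Type) (s : X -> W) : Prop :=
  finite_set (range s) /\ forall w, measurable (s @^-1` [set w]).

Lemma finitely_valued_preimage (W : Type) (s : X -> W) (Y : set W) :
  finitely_valued s -> measurable (s @^-1` Y).
Proof.
move=> [fs ms].
have -> : s @^-1` Y = \bigcup_(w in range s `&` Y) (s @^-1` [set w]).
  apply/seteqP; split => [x Yx|x [w [_ Yw] /= ->] //].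
  by exists (s x) => //; split => //; exists x.
by apply: fin_bigcup_measurable => [|w _]; [exact: finite_setIl|exact: ms].
Qed.

Lemma finitely_valued_comp (W W' : Type) (phi : W -> W') (s : X -> W) :
  finitely_valued s -> finitely_valued (phi \o s).
Proof.
move=> fs; split=> [|w].
  by rewrite -(image_comp s phi); exact: finite_image fs.1.
by rewrite comp_preimage; exact: finitely_valued_preimage.
Qed.

Lemma finitely_valued_pair (W W' : Type) (s : X -> W) (t : X -> W') :
  finitely_valued s -> finitely_valued t ->
  finitely_valued (fun x => (s x, t x)).
Proof.
move=> [fs ms] [ft mt]; split=> [|[w w']].
  apply: (@sub_finite_set _ _ (range s `*` range t)); last exact: finite_setX.
  by move=> _ [x _ <-]; split; exists x.
have -> : (fun x => (s x, t x)) @^-1` [set (w, w')] =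
    s @^-1` [set w] `&` t @^-1` [set w'].
  by apply/seteqP; split => x /= [-> ->].
exact: measurableI.
Qed.

Lemma finitely_valued_cst (W : Type) (w : W) : finitely_valued (fun _ : X => w).
Proof.
split=> [|w'].
  by apply: (@sub_finite_set _ _ [set w]) => // _ [x _ <-].
by have [->|ne] := pselect (w = w'); rewrite preimage_cst;
  case: ifP => // _; exact: measurable0.
Qed.

Lemma finitely_valued_indic (A : set X) : measurable A ->
  finitely_valued (\1_A : X -> R).
Proof.
move=> mA; split=> [|w].
  apply: (@sub_finite_set _ _ [set 0; 1]) => // _ [x _ <-].
  by rewrite indicE; case: (_ \in _); [right|left].
by rewrite preimage_indic; do 2 case: ifP => _ //; exact: measurableC.
Qed.

Lemma finitely_valued_measurable (s : X -> R) :
  finitely_valued s -> measurable_fun setT s.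
Proof. by move=> fs _ Y mY; rewrite setTI; exact: finitely_valued_preimage. Qed.

End finitely_valued.

Section strong_measurability.
Context (d : measure_display) (X : measurableType d) (R : realType).

(** Sequential continuity of [phi] is all that the approximation requires; sums, opposites and
    products by an indicator are instances. *)
Lemma strongly_measurable_comp2 (U V W : normedModType R) (phi : U -> V -> W)
    (f : X -> U) (g : X -> V) :
  (forall (s : nat -> U) (t : nat -> V) u v, s n @[n --> \oo] --> u ->
     t n @[n --> \oo] --> v -> phi (s n) (t n) @[n --> \oo] --> phi u v) ->
  strongly_measurable f -> strongly_measurable g ->
  strongly_measurable (fun x => phi (f x) (g x)).
Proof.
move=> cphi [s fs sf] [t ft tg].
exists (fun n x => phi (s n x) (t n x)) => [n|x]; last first.
  exact: (cphi (s ^~ x) (t ^~ x)).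
exact: (finitely_valued_comp (fun p => phi p.1 p.2)
         (finitely_valued_pair (fs n) (ft n))).
Qed.

Lemma strongly_measurable_cst (U : normedModType R) (u : U) :
  strongly_measurable (fun _ : X => u).
Proof.
exists (fun _ _ => u) => [n|x]; first exact: finitely_valued_cst.
exact: cvg_cst.
Qed.

Lemma strongly_measurable_indic (A : set X) : measurable A ->
  strongly_measurable (\1_A : X -> R^o).
Proof.
move=> mA; exists (fun _ => \1_A) => [n|x]; first exact: finitely_valued_indic.
exact: cvg_cst.
Qed.

Context (U : normedModType R).
Implicit Types (f g : X -> U).

Lemma strongly_measurableD f g : strongly_measurable f ->
  strongly_measurable g -> strongly_measurable (fun x => f x + g x).
Proof.
by apply: (strongly_measurable_comp2 (phi := +%R)) => s t u v; exact: cvgD.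
Qed.

Lemma strongly_measurableN f : strongly_measurable f ->
  strongly_measurable (fun x => - f x).
Proof.
move=> mf; apply: (strongly_measurable_comp2 (phi := fun u _ : U => - u)) (mf) (mf).
by move=> s t u v su _; exact: cvgN.
Qed.

Lemma strongly_measurable_cutoff (A : set X) f : measurable A ->
  strongly_measurable f -> strongly_measurable (cutoff A f).
Proof.
move=> mA; apply: (@strongly_measurable_comp2 R^o U U (fun a u => a *: u)) => //.
  by move=> s t u v; exact: cvgZ.
exact: strongly_measurable_indic.
Qed.

Lemma strongly_measurable_norm f : strongly_measurable f ->
  measurable_fun setT (fun x => `|f x|).
Proof.
move=> [s fs sf].
apply: (@measurable_fun_cvg _ X R setT (fun n x => `|s n x|)) => [n|x _].
  apply: finitely_valued_measurable.
  exact: (finitely_valued_comp (fun u => `|u|) (fs n)).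
by apply: cvg_norm; exact: sf.
Qed.

End strong_measurability.

(** * The Bochner integral *)

Section simple_integral.
Context (d : measure_display) (X : measurableType d) (R : realType).
Context (mu : {measure set X -> \bar R}) (U : normedModType R).
Implicit Types (A : set X).

Lemma fin_num_setI A (E : set X) : measurable A -> (mu A < +oo)%E ->
  measurable E -> mu (A `&` E) \is a fin_num.
Proof.
move=> mA fA mE; rewrite ge0_fin_numE//; apply: le_lt_trans fA.
by apply: le_measure; rewrite ?inE//; exact: measurableI.
Qed.

(** The integral may be computed on a partition finer than the level sets: the levels of [p] with
    the same image under [phi] are regrouped. With [p] a pair, two simple functions are integrated
    on one partition. *)
Lemma simple_integral_comp (W : choiceType) (p : X -> W) (phi : W -> U) A :
  measurable A -> (mu A < +oo)%E -> finitely_valued p ->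
  simple_integral mu A (phi \o p) =
  \sum_(w <- fset_set (range p)) fine (mu (A `&` p @^-1` [set w])) *: phi w.
Proof.
move=> mA fA fp; have [fr mp] := fp.
have level u : fine (mu (A `&` (phi \o p) @^-1` [set u])) =
    \sum_(w <- fset_set (range p) | phi w == u)
      fine (mu (A `&` p @^-1` [set w])).
  rewrite sum_fine; last by move=> w _; exact: fin_num_setI.
  congr fine; rewrite big_mkcond.
  have -> : A `&` (phi \o p) @^-1` [set u] = \bigcup_(w in range p)
      (if phi w == u then A `&` p @^-1` [set w] else set0).
    apply/seteqP; split=> [x [Ax /= pu]|x [_ [y _ <-]]].
      by exists (p x); [exists x|rewrite pu eqxx].
    by case: eqP => // pu [Ax /= ->].
  rewrite measure_fin_bigcup//; last 2 first.
  - move=> w w' _ _ [x []]; case: ifP => // _ [_ /= <-].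
    by case: ifP => // _ [_ /= <-].
  - by move=> w _; case: ifP => // _; exact: measurableI.
  rewrite fsbig_finite//; apply: eq_bigr => w _.
  by case: ifP => // _; rewrite measure0.
rewrite /simple_integral fsbig_finite; last first.
  exact: (finitely_valued_comp phi fp).1.
under eq_bigr do rewrite level scaler_suml.
rewrite (exchange_big_dep xpredT)//= big_seq [RHS]big_seq.
apply: eq_bigr => w wr.
(* The inner sum is over the values [u] equal to [phi w], hence has a single term. *)
rewrite -big_filter (perm_big [:: phi w]) ?big_seq1//.
apply: uniq_perm => //; first by rewrite filter_uniq// fset_uniq.
move=> u; rewrite mem_filter inE eq_sym andb_idr// => /eqP ->.
rewrite in_fset_set; last exact: (finitely_valued_comp phi fp).1.
by move: wr; rewrite in_fset_set// !inE => -[x _ <-]; exists x.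
Qed.

Lemma simple_integral_cst A (u : U) :
  simple_integral mu A (fun _ => u) = fine (mu A) *: u.
Proof.
rewrite /simple_integral.
have -> : range (fun _ : X => u) = [set u].
  by apply/seteqP; split=> [_ [x _ <-]//|_ ->]; exists point.
rewrite fsbig_set1; congr (fine (mu _) *: u).
by apply/seteqP; split=> [x []//|x Ax]; split.
Qed.

Lemma integral_finitely_valued (W : choiceType) (p : X -> W) (g : W -> R) A :
  measurable A -> (mu A < +oo)%E -> finitely_valued p ->
  (forall w, 0 <= g w) ->
  (\int[mu]_(x in A) (g (p x))%:E)%E =
  (\sum_(w <- fset_set (range p)) fine (mu (A `&` p @^-1` [set w])) * g w)%:E.
Proof.
move=> mA fA fp g0; have [fr mp] := fp.
have -> : (\int[mu]_(x in A) (g (p x))%:E)%E = (\int[mu]_(x in A)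
    \sum_(w \in range p) (g w * \1_(p @^-1` [set w]) x)%:E)%E.
  apply: eq_integral => x _.
  rewrite (fsbigD1 (p x))//= ?fsbig1 ?adde0; last by exists x.
    by rewrite indicE mem_set// mulr1.
  move=> w [_ /= wp]; rewrite indicE memNset ?mulr0// => /= pw.
  by apply: wp.
rewrite ge0_integral_fsum//; last 2 first.
- by move=> w; apply/measurable_EFinP; exact: measurable_funM.
- by move=> w x _; rewrite lee_fin mulr_ge0.
rewrite fsbig_finite//= -sumEFin; apply: eq_bigr => w _.
under eq_integral do rewrite EFinM.
rewrite ge0_integralZl_EFin//=; last first.
  by apply/measurable_EFinP; exact: measurable_indic.
rewrite integral_indic// setIC -[in LHS](@fineK _ (mu _)) ?fin_num_setI//.
by rewrite -EFinM mulrC.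
Qed.

(** On the joint partition both integrals have the same weights, so the triangle inequality applies
    term by term. *)
Lemma simple_integral_dist (s t : X -> U) A :
  measurable A -> (mu A < +oo)%E -> simple_function s -> simple_function t ->
  (`|simple_integral mu A s - simple_integral mu A t|%:E
    <= \int[mu]_(x in A) `|s x - t x|%:E)%E.
Proof.
move=> mA fA fs ft; have fp := finitely_valued_pair fs ft.
set p := fun x => (s x, t x) in fp *.
rewrite (simple_integral_comp fst mA fA fp) (simple_integral_comp snd mA fA fp).
rewrite (integral_finitely_valued (g := fun w => `|w.1 - w.2|) mA fA fp)//.
rewrite lee_fin -sumrB (le_trans (ler_norm_sum _ _ _))// ler_sum// => w _.
by rewrite -scalerBr normrZ ger0_norm// fine_ge0.
Qed.
End simple_integral.

Section bochner.
Context (d : measure_display) (X : measurableType d) (R : realType).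
Context (mu : {measure set X -> \bar R}).

Lemma simple_strongly_measurable (U : normedModType R) (s : X -> U) :
  simple_function s -> strongly_measurable s.
Proof. by move=> fs; exists (fun _ => s) => // x; exact: cvg_cst. Qed.

Lemma measurable_norm_dist (U : normedModType R) (A : set X) (f g : X -> U) :
  strongly_measurable f -> strongly_measurable g ->
  measurable_fun A (fun x => (`|f x - g x|)%:E).
Proof.
move=> mf mg; apply/measurable_EFinP; apply: measurable_funTS.
apply: strongly_measurable_norm; apply: strongly_measurableD => //.
exact: strongly_measurableN.
Qed.

Lemma integral_dist_triangle (U : normedModType R) (A : set X) (f g h : X -> U) :
  measurable A -> strongly_measurable f -> strongly_measurable g ->
  strongly_measurable h ->
  (\int[mu]_(x in A) (`|f x - h x|)%:E <= \int[mu]_(x in A) (`|f x - g x|)%:E +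
     \int[mu]_(x in A) (`|g x - h x|)%:E)%E.
Proof.
move=> mA mf mg mh; rewrite -ge0_integralD//; try exact: measurable_norm_dist.
apply: ge0_le_integral => //; first exact: measurable_norm_dist.
- by apply: emeasurable_funD; exact: measurable_norm_dist.
- by move=> x _; rewrite -EFinD lee_fin; exact: ler_distD.
Qed.

Lemma cvge0_near_lt (a : nat -> \bar R) (e : R) : 0 < e ->
  a n @[n --> \oo] --> 0%E -> \forall n \near \oo, (a n < e%:E)%E.
Proof.
move=> e0 /fine_cvgP[fa ca].
near=> n; rewrite -(@fineK _ (a n)); last by near: n.
by rewrite lte_fin; near: n; exact: cvgr_lt ca _ e0.
Unshelve. all: by end_near. Qed.

(** Passage to the limit in [simple_integral_dist], with a constant as second function. It is proved
    for every candidate [v], to be applied to the one that [xget] selects. *)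
Lemma is_bochner_integral_dist (U : normedModType R) (A : set X) (f : X -> U)
    (u v : U) :
  measurable A -> (mu A < +oo)%E -> strongly_measurable f ->
  is_bochner_integral mu A f v ->
  ((`|v - fine (mu A) *: u|)%:E <= \int[mu]_(x in A) (`|f x - u|)%:E)%E.
Proof.
move=> mA fA mf [s [fs cs sv]]; apply/lee_addgt0Pr => e e0.
have e20 : 0 < e / 2 by rewrite divr_gt0.
have : \forall n \near \oo, (\int[mu]_(x in A) (`|s n x - f x|)%:E
    < (e / 2)%:E)%E /\ `|v - simple_integral mu A (s n)| < e / 2.
  near=> n; split; near: n; first exact: cvge0_near_lt.
  exact: cvgr_dist_lt sv _ e20.
case=> n _ /(_ n (leqnn n))[h1 h2].
have fu : simple_function (fun _ : X => u) by exact: finitely_valued_cst.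
have h3 := simple_integral_dist mA fA (fs n) fu.
rewrite simple_integral_cst in h3.
apply: (@le_trans _ _ ((e / 2)%:E + \int[mu]_(x in A) (`|s n x - u|)%:E)%E).
  apply: le_trans (leeD2l _ h3); rewrite -EFinD lee_fin.
  by rewrite (le_trans (ler_distD (simple_integral mu A (s n)) _ _))// lerD2r ltW.
have mu_ : strongly_measurable (fun _ : X => u) := strongly_measurable_cst _ u.
have := integral_dist_triangle mA (simple_strongly_measurable (fs n)) mf mu_.
move/(@leeD2l _ (e / 2)%:E)/le_trans; apply.
apply: le_trans (leeD2l _ (leeD2r _ (ltW h1))) _.
by rewrite [leRHS]addeC [leLHS]addeA leeD2r// -EFinD -splitr.
Unshelve. all: by end_near. Qed.

(** The simple functions [t n] converge pointwise only. Cutting them off where they exceed [2 * |f|]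
    makes [3 * |f|] dominate the differences and keeps the limit: where [f] is not 0 the cutoff is
    eventually inactive, and where [f] is 0 it yields 0. Dominated convergence makes the simple
    integrals a Cauchy sequence, and [U] is complete. *)
Lemma is_bochner_integral_exists (U : completeNormedModType R) (A : set X)
    (f : X -> U) :
  measurable A -> (mu A < +oo)%E -> strongly_measurable f ->
  (\int[mu]_(x in A) (`|f x|)%:E < +oo)%E ->
  exists v, is_bochner_integral mu A f v.
Proof.
move=> mA fA mf If; have [t ft tf] := mf.
pose G n := [set x | `|t n x| <= 2 * `|f x|].
pose s n := cutoff (G n) (t n).
have mG n : measurable (G n).
  rewrite -[G n]setTI; apply: measurable_fun_le => //.
    apply: strongly_measurable_norm; exact: simple_strongly_measurable.
  by apply: measurable_funM => //; exact: strongly_measurable_norm.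
have fs n : simple_function (s n).
  exact: (finitely_valued_comp (fun p => p.1 *: p.2)
    (finitely_valued_pair (finitely_valued_indic R (mG n)) (ft n))).
have sf x : s n x @[n --> \oo] --> f x.
  have [fx0|fx0] := eqVneq (f x) 0.
    rewrite fx0 (_ : (fun n => s n x) = fun=> 0); first exact: cvg_cst.
    apply/funext => n; rewrite /s /cutoff indicE.
    case: (boolP (x \in G n)) => [|_]; last by rewrite scale0r.
    rewrite inE /G /= fx0 normr0 mulr0 normr_le0 => /eqP ->.
    by rewrite scaler0.
  apply: cvg_trans (tf x); apply: near_eq_cvg.
  have : `|f x| < 2 * `|f x| by rewrite ltr_pMl ?normr_gt0// ltr1n.
  move=> fx; near=> n; rewrite /s /cutoff indicE mem_set ?scale1r//.
  by rewrite /G /=; near: n; exact: cvgr_norm_le (tf x) _ fx.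
have cs : (\int[mu]_(x in A) (`|s n x - f x|)%:E)%E @[n --> \oo] --> 0%E.
  have mf1 : measurable_fun A (fun x => (`|f x|)%:E).
    by apply/measurable_EFinP; apply: measurable_funTS; exact: strongly_measurable_norm.
  have [|||||_ + _] := @dominated_convergence _ _ _ mu A mA
    (fun n x => (`|s n x - f x|)%:E) (fun=> 0%E) (fun x => (3 * `|f x|)%:E).
  - by move=> n; apply: measurable_norm_dist => //; exact: simple_strongly_measurable.
  - exact: measurable_cst.
  - apply: nearW => x _; apply/fine_cvgP; split; first exact: nearW.
have h : s n x - f x @[n --> \oo] --> (0 : U).
      by rewrite -(subrr (f x)); apply: cvgB; [exact: sf|exact: cvg_cst].
    have : `|s n x - f x| @[n --> \oo] --> `|0 : U| by exact: cvg_norm.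
    by rewrite normr0.
  - apply/integrableP; split.
      by apply/measurable_EFinP; apply: measurable_funM => //; exact/measurable_EFinP.
    rewrite (eq_integral (fun x => 3%:E * (`|f x|)%:E)%E); last first.
      by move=> x _; rewrite /= ger0_norm ?mulr_ge0// EFinM.
    by rewrite ge0_integralZl_EFin//= lte_mul_pinfty.
  - apply: nearW => x n _; rewrite lee_fin normr_id.
    rewrite (le_trans (ler_normB _ _))//.
    suff : `|s n x| <= 2 * `|f x| by lra.
    rewrite /s /cutoff indicE.
    case: (boolP (x \in G n)) => [|_]; last by rewrite scale0r normr0 mulr_ge0.
    by rewrite inE scale1r.
  rewrite [X in X @ _ --> _ -> _](_ : _ =
    (fun n => \int[mu]_(x in A) (`|s n x - f x|)%:E)%E)//.
  apply/funext => n; apply: eq_integral => x _.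
  by rewrite sube0 abse_EFin normr_id.
have : cvg (simple_integral mu A (s n) @[n --> \oo]).
  apply: cauchy_cvg; apply: cauchy_exP => e e0.
  have e20 : 0 < e / 2 by rewrite divr_gt0.
  have [N _ hN] := cvge0_near_lt e20 cs.
  exists (simple_integral mu A (s N)).
  exists N => // n /= Nn; rewrite -ball_normE /= -lte_fin.
  apply: le_lt_trans (simple_integral_dist mA fA (fs N) (fs n)) _.
  apply: le_lt_trans (integral_dist_triangle mA _ mf _) _;
    try exact: simple_strongly_measurable.
  rewrite [e]splitr EFinD; apply: lteD; first exact: (hN N (leqnn N)).
  by under eq_integral do rewrite distrC; exact: hN.
by move=> /cvg_ex[v sv]; exists v, s.
Unshelve. all: by end_near. Qed.

Lemma bochner_integral_dist (U : completeNormedModType R) (A : set X)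
    (f : X -> U) (u : U) :
  measurable A -> (mu A < +oo)%E -> strongly_measurable f ->
  (\int[mu]_(x in A) (`|f x|)%:E < +oo)%E ->
  ((`|bochner_integral mu A f - fine (mu A) *: u|)%:E
    <= \int[mu]_(x in A) (`|f x - u|)%:E)%E.
Proof.
move=> mA fA mf If; apply: is_bochner_integral_dist => //.
exact: (xgetPex 0 (is_bochner_integral_exists mA fA mf If)).
Qed.
End bochner.

(** * Means of order r *)

Section Lr_means.
Context (d : measure_display) (X : measurableType d) (R : realType).
Context (mu : {measure set X -> \bar R}) (r : R) (r1 : 1 <= r).

Let r0 : 0 < r. Proof. exact: lt_le_trans ltr01 r1. Qed.

Lemma powR_norm_add (U : normedModType R) (u v : U) :
  `|u + v| `^ r <= 2 `^ r * `|u| `^ r + 2 `^ r * `|v| `^ r.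
Proof.
wlog vu : u v / `|v| <= `|u|.
  move=> h; have [|/ltW uv] := leP `|v| `|u|; first exact: h.
  by rewrite addrC [leRHS]addrC; exact: h.
rewrite ler_wpDr ?mulr_ge0 ?powR_ge0// -powRM//.
apply: ge0_ler_powR; rewrite ?nnegrE ?mulr_ge0 ?(ltW r0)//.
by rewrite (le_trans (ler_normD _ _))// mulr_natl mulr2n lerD2l.
Qed.

Context (U : normedModType R).
Implicit Types (A C : set X) (f g : X -> U) (a b c : R).

Lemma measurable_powR_norm A f : strongly_measurable f ->
  measurable_fun A (fun x => (`|f x| `^ r)%:E).
Proof.
move=> mf; apply/measurable_EFinP; apply: measurable_funTS.
apply: (measurableT_comp (f := fun y => y `^ r)); first exact: measurable_powR.
exact: strongly_measurable_norm.
Qed.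

Lemma integral_powR_normD A f g : measurable A -> strongly_measurable f ->
  strongly_measurable g ->
  (\int[mu]_(x in A) (`|f x + g x| `^ r)%:E <=
   (2 `^ r)%:E * \int[mu]_(x in A) (`|f x| `^ r)%:E +
   (2 `^ r)%:E * \int[mu]_(x in A) (`|g x| `^ r)%:E)%E.
Proof.
move=> mA mf mg.
have Z (h : X -> U) : strongly_measurable h ->
    ((2 `^ r)%:E * \int[mu]_(x in A) (`|h x| `^ r)%:E)%E =
    (\int[mu]_(x in A) ((2 `^ r)%:E * (`|h x| `^ r)%:E))%E.
  move=> mh; rewrite ge0_integralZl_EFin ?powR_ge0//.
  exact: measurable_powR_norm.
rewrite [X in (_ <= X + _)%E](Z f mf) [X in (_ <= _ + X)%E](Z g mg).
rewrite -ge0_integralD//;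
  try by [apply: measurable_funeM; exact: measurable_powR_norm
         | move=> x _; rewrite -EFinM lee_fin mulr_ge0 ?powR_ge0].
apply: ge0_le_integral => //.
- by apply: measurable_powR_norm; exact: strongly_measurableD.
- by apply: emeasurable_funD; apply: measurable_funeM; exact: measurable_powR_norm.
- by move=> x _; rewrite -!EFinM -EFinD lee_fin; exact: powR_norm_add.
Qed.

Lemma in_Lr_integral_lty A f : measurable A -> in_Lr mu r f ->
  (\int[mu]_(x in A) (`|f x| `^ r)%:E < +oo)%E.
Proof.
move=> mA [mf ff]; apply: le_lt_trans ff; apply: ge0_subset_integral => //.
exact: measurable_powR_norm.
Qed.

Lemma in_LrD f g : in_Lr mu r f -> in_Lr mu r g ->
  in_Lr mu r (fun x => f x + g x).
Proof.
move=> [mf ff] [mg fg]; split; first exact: strongly_measurableD.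
apply: le_lt_trans (integral_powR_normD measurableT mf mg) _.
have p2 : (0 <= (2 `^ r)%:E :> \bar R)%E by rewrite lee_fin powR_ge0.
exact: (lte_add_pinfty (lte_mul_pinfty p2 isT ff) (lte_mul_pinfty p2 isT fg)).
Qed.

Lemma in_LrN f : in_Lr mu r f -> in_Lr mu r (fun x => - f x).
Proof.
move=> [mf ff]; split; first exact: strongly_measurableN.
by under eq_integral do rewrite normrN.
Qed.

Lemma integral_powR_norm_cutoff A C f : measurable A -> measurable C ->
  strongly_measurable f ->
  (\int[mu]_(x in C) (`|cutoff A f x| `^ r)%:E
    = \int[mu]_(x in C `&` A) (`|f x| `^ r)%:E)%E.
Proof.
move=> mA mC mf; rewrite integral_mkcondr; apply: eq_integral => x _.
rewrite /cutoff indicE /patch; case: ifP => _; first by rewrite scale1r.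
by rewrite scale0r normr0 powR0// gt_eqF.
Qed.

Lemma in_Lr_cutoff A f : measurable A -> in_Lr mu r f ->
  in_Lr mu r (cutoff A f).
Proof.
move=> mA [mf ff]; split; first exact: strongly_measurable_cutoff.
by rewrite integral_powR_norm_cutoff// setTI; exact: in_Lr_integral_lty.
Qed.

Lemma in_Lr_cutoff_cst A (u : U) : measurable A -> (mu A < +oo)%E ->
  in_Lr mu r (cutoff A (fun=> u)).
Proof.
move=> mA fA; have mu_ := strongly_measurable_cst X u.
split; first exact: strongly_measurable_cutoff.
rewrite integral_powR_norm_cutoff// setTI integral_cst//.
by rewrite lte_mul_pinfty// lee_fin powR_ge0.
Qed.

(** The estimate [<f>_A <= c] cleared of the quotient and of the root; [mean_normP] relates the two
    forms. *)
Definition Lr_bound A f c : Prop :=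
  (\int[mu]_(x in A) (`|f x| `^ r)%:E <= (c `^ r * fine (mu A))%:E)%E.

Lemma mean_normP A f c : (0 < mu A < +oo)%E -> 0 <= c ->
  (mean_norm mu r f A <= c%:E)%E <-> Lr_bound A f c.
Proof.
move=> /fine_gt0 m0 c0; rewrite /mean_norm /Lr_bound.
have : (0 <= \int[mu]_(x in A) (`|f x| `^ r)%:E)%E.
  by apply: integral_ge0 => x _; rewrite lee_fin powR_ge0.
case: (\int[mu]_(x in A) _)%E => [i| |]//.
- rewrite lee_fin => i0; rewrite -EFinM poweR_EFin !lee_fin.
  rewrite mulrC -ler_pdivrMr//.
  have h0 : 0 <= i / fine (mu A) by rewrite divr_ge0// ltW.
  split=> h.
  + rewrite -[leLHS](powRr1 h0) -(mulVf (lt0r_neq0 r0)) powRrM.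
    by apply: ge0_ler_powR; rewrite ?nnegrE ?powR_ge0 ?(ltW r0).
  + rewrite -[leRHS](powRr1 c0) -(mulfV (lt0r_neq0 r0)) powRrM.
    by apply: ge0_ler_powR; rewrite ?nnegrE ?powR_ge0 ?invr_ge0 ?(ltW r0).
- move=> _; rewrite gt0_muley ?lte_fin ?invr_gt0//.
  by rewrite poweRyr ?invr_neq0 ?gt_eqF//; split; rewrite leye_eq.
Qed.

Lemma Lr_bound_le A f a b : 0 <= a -> a <= b -> Lr_bound A f a -> Lr_bound A f b.
Proof.
move=> a0 ab /le_trans; apply; rewrite lee_fin ler_wpM2r ?fine_ge0//.
by apply: ge0_ler_powR; rewrite ?nnegrE ?(ltW r0)//; exact: le_trans ab.
Qed.

Lemma Lr_bound_cst A (u : U) : measurable A -> (mu A < +oo)%E ->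
  Lr_bound A (fun=> u) `|u|.
Proof.
by move=> mA fA; rewrite /Lr_bound integral_cst// EFinM fineK// ge0_fin_numE.
Qed.

(** A crude Minkowski inequality. One factor 2 comes from [powR_norm_add], the other from [a^r + b^r
    <= 2 (a + b)^r <= (2 (a + b))^r]. *)
Lemma Lr_boundD A f g a b : measurable A -> strongly_measurable f ->
  strongly_measurable g -> 0 <= a -> 0 <= b ->
  Lr_bound A f a -> Lr_bound A g b ->
  Lr_bound A (fun x => f x + g x) (4 * (a + b)).
Proof.
move=> mA mf mg a0 b0 fa gb; have m0 : 0 <= fine (mu A) by exact: fine_ge0.
have ab0 : 0 <= a + b by exact: addr_ge0.
apply: le_trans (integral_powR_normD mA mf mg) _.
have p2 : (0 <= (2 `^ r)%:E)%E by rewrite lee_fin powR_ge0.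
apply: le_trans (leeD (lee_wpmul2l p2 fa) (lee_wpmul2l p2 gb)) _.
rewrite -!EFinM -EFinD lee_fin !mulrA -mulrDl ler_wpM2r// -mulrDr.
rewrite (_ : 4 = 2 * 2 :> R); last by ring.
rewrite -mulrA (powRM _ _ (mulr_ge0 _ ab0))// ler_wpM2l ?powR_ge0//.
rewrite powRM//.
have h c : 0 <= c -> c <= a + b -> c `^ r <= (a + b) `^ r.
  by move=> c0 cab; apply: ge0_ler_powR; rewrite ?nnegrE ?(ltW r0).
apply: (@le_trans _ _ (2 * (a + b) `^ r)).
  by rewrite mulr_natl mulr2n lerD// h// ?lerDl// lerDr.
rewrite ler_wpM2r ?powR_ge0//.
by rewrite -[leLHS](@powRr1 _ 2)// ler_powR// ler1n.
Qed.

(** The ratio of the measures is at most [k], and [k <= k^r] because [r >= 1]. *)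
Lemma Lr_bound_subset A C f c (k : R) : measurable A -> measurable C ->
  strongly_measurable f -> A `<=` C -> 0 <= c -> 1 <= k ->
  fine (mu C) <= k * fine (mu A) -> Lr_bound C f c -> Lr_bound A f (k * c).
Proof.
move=> mA mC mf AC c0 k1 Ck fc; have k0 : 0 <= k by exact: le_trans k1.
apply: (@le_trans _ _ (\int[mu]_(x in C) (`|f x| `^ r)%:E)%E).
  by apply: ge0_subset_integral => //; exact: measurable_powR_norm.
apply: le_trans fc _; rewrite lee_fin powRM// mulrAC [leRHS]mulrC.
rewrite ler_wpM2l ?powR_ge0// (le_trans Ck)// ler_wpM2r ?fine_ge0//.
by rewrite -[leLHS](@powRr1 _ k)// ler_powR.
Qed.

(* For c > 0 and h >= 0 one has h <= c + h^r c^(1 - r), by comparing h to c;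
   integrating it replaces Jensen's inequality. *)
Lemma Lr_bound_integral A f c : measurable A -> (mu A < +oo)%E ->
  strongly_measurable f -> 0 < c -> Lr_bound A f c ->
  (\int[mu]_(x in A) (`|f x|)%:E <= (2 * c * fine (mu A))%:E)%E.
Proof.
move=> mA fA mf c0 fc.
have cr0 : 0 <= c `^ (1 - r) by rewrite powR_ge0.
apply: (@le_trans _ _ (\int[mu]_(x in A)
    (c%:E + (c `^ (1 - r))%:E * (`|f x| `^ r)%:E))%E).
  apply: ge0_le_integral => //.
  - apply/measurable_EFinP; apply: measurable_funTS.
    exact: strongly_measurable_norm.
  - apply: emeasurable_funD => //; apply: measurable_funeM.
    exact: measurable_powR_norm.
  move=> x _; rewrite -EFinM -EFinD lee_fin.
  have [hc|ch] := leP `|f x| c; first by rewrite ler_wpDr// mulr_ge0// powR_ge0.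
  rewrite ler_wpDl ?(ltW c0)//.
  have h0 : 0 < `|f x| by exact: lt_trans ch.
  apply: (@le_trans _ _ (`|f x| `^ (1 - r) * `|f x| `^ r)).
    by rewrite -powRD ?(gt_eqF h0) ?implybT// subrK powRr1.
  rewrite ler_wpM2r ?powR_ge0//.
  rewrite -[1 - r]opprB !powRN lef_pV2 ?posrE ?powR_gt0//.
  by apply: ge0_ler_powR; rewrite ?nnegrE ?subr_ge0 ?(ltW c0) ?(ltW h0) ?(ltW ch).
rewrite ge0_integralD//=; last 3 first.
- by move=> x _; rewrite lee_fin ltW.
- by move=> x _; rewrite -EFinM lee_fin mulr_ge0 ?powR_ge0.
- by apply: measurable_funeM; exact: measurable_powR_norm.
rewrite integral_cst// ge0_integralZl_EFin//; last exact: measurable_powR_norm.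
rewrite -[mu A in X in (X <= _)%E](@fineK _ (mu A)) ?ge0_fin_numE//.
apply: le_trans (leeD2l _ (lee_wpmul2l _ fc)) _; first by rewrite lee_fin.
rewrite -!EFinM -EFinD lee_fin mulrA -powRD; last by rewrite (gt_eqF c0) implybT.
by rewrite subrK powRr1 ?(ltW c0)// -mulrA mulr_natl mulr2n.
Qed.
(** The constant is the L^r norm of [f] divided by mu(B)^(1/r). This is what makes [mean_osc_sup]
    finite. *)
Lemma Lr_bound_uniform f (B : set X) : measurable B -> (0 < mu B < +oo)%E ->
  in_Lr mu r f -> exists2 c, 0 <= c & forall C, measurable C ->
    (mu C < +oo)%E -> B `<=` C -> Lr_bound C f c.
Proof.
move=> mB Bfin [mf ff]; have m0 := fine_gt0 Bfin.
set i := (\int[mu]_x (`|f x| `^ r)%:E)%E in ff.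
have i0 : (0 <= i)%E by apply: integral_ge0 => x _; rewrite lee_fin powR_ge0.
have fi0 : 0 <= fine i / fine (mu B) by rewrite divr_ge0 ?fine_ge0// ltW.
exists ((fine i / fine (mu B)) `^ r^-1); first exact: powR_ge0.
move=> C mC Cfin BC; apply: (@le_trans _ _ i).
  by apply: ge0_subset_integral => //; exact: measurable_powR_norm.
rewrite -powRrM mulVf ?gt_eqF// powRr1//.
rewrite -[leLHS]fineK ?ge0_fin_numE// lee_fin -[leLHS](divfK (lt0r_neq0 m0)).
rewrite ler_wpM2l// fine_le ?ge0_fin_numE//; first by case/andP: Bfin.
by rewrite le_measure ?inE.
Qed.
End Lr_means.

Section Lr_mean_value.
Context (d : measure_display) (X : measurableType d) (R : realType).
Context (mu : {measure set X -> \bar R}) (r : R) (r1 : 1 <= r).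
Context (U : completeNormedModType R).
Implicit Types (A B C : set X) (f : X -> U) (u : U) (c : R).

Lemma Lr_bound_mean_dist A f u c :
  measurable A -> (0 < mu A < +oo)%E -> strongly_measurable f -> 0 <= c ->
  Lr_bound mu r A (fun x => f x - u) c -> `|mean mu f A - u| <= 2 * c.
Proof.
move=> mA Afin mf c0 fuc; have m0 := fine_gt0 Afin.
have fA : (mu A < +oo)%E by case/andP: Afin.
apply/ler_addgt0Pr => e e0.
(* [Lr_bound_integral] asks for a positive bound while [c] may be 0; its factor 2 turns the excess
   [e / 2] into [e]. *)
have c'0 : 0 < c + e / 2 by rewrite ltr_wpDl// divr_gt0.
have mu_ : strongly_measurable (fun _ : X => u) := strongly_measurable_cst X u.
have mfu : strongly_measurable (fun x => f x - u).
  by apply: strongly_measurableD => //; exact: strongly_measurable_cst.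
have cc' : c <= c + e / 2 by rewrite lerDl divr_ge0// ltW.
have I1 := Lr_bound_integral r1 mA fA mfu c'0 (Lr_bound_le r1 c0 cc' fuc).
have If : (\int[mu]_(x in A) (`|f x|)%:E < +oo)%E.
  have := integral_dist_triangle mu mA mf mu_ (strongly_measurable_cst X 0).
  under eq_integral do rewrite subr0.
  move=> /le_lt_trans; apply; apply: lte_add_pinfty.
    by apply: le_lt_trans I1 _; rewrite ltry.
  by rewrite integral_cst//; apply: lte_mul_pinfty; rewrite ?lee_fin.
have := le_trans (bochner_integral_dist u mA fA mf If) I1.
rewrite lee_fin => h.
have -> : mean mu f A - u =
    (fine (mu A))^-1 *: (bochner_integral mu A f - fine (mu A) *: u).
  by rewrite scalerBr scalerA mulVf ?gt_eqF// scale1r.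
rewrite normrZ gtr0_norm ?invr_gt0// ler_pdivrMl// (le_trans h)//.
by rewrite mulrC ler_wpM2l ?(ltW m0)// mulrDr mulrCA divff// mulr1.
Qed.

(** All means of [f] over balls containing [B] are at most some [c], so [|f_C| <= 2 * c] and the
    oscillations are at most [4 * (c + 2 * c)]. From here on the supremum is a real number [S]. *)
Lemma mean_osc_sup_fin (BB : set (set X)) f B :
  (forall C, BB C -> measurable C /\ (0 < mu C < +oo)%E) -> BB B ->
  in_Lr mu r f -> exists S, [/\ 0 <= S, mean_osc_sup mu BB r f B = S%:E &
    forall C, BB C -> B `<=` C -> Lr_bound mu r C (fun x => f x - mean mu f C) S].
Proof.
move=> BBm BBB fL; have [mB Bfin] := BBm _ BBB; have mf := fL.1.
have [c c0 hc] := Lr_bound_uniform r1 mB Bfin fL.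
have osc C : BB C -> B `<=` C -> (mean_osc mu r f C <= (4 * (c + 2 * c))%:E)%E.
  move=> /BBm[mC Cfin] BC; have Cf : (mu C < +oo)%E by case/andP: Cfin.
  have fC := hc C mC Cf BC.
  apply/(mean_normP r1) => //; first by rewrite mulr_ge0// addr_ge0// mulr_ge0.
  apply: Lr_boundD => //; rewrite ?mulr_ge0//.
    exact: strongly_measurable_cst.
  apply: Lr_bound_le (Lr_bound_cst _ _ mC Cf) => //; rewrite normrN.
  have := @Lr_bound_mean_dist C f 0 c mC Cfin mf c0; rewrite subr0; apply.
  by rewrite (_ : (fun x => f x - 0) = f)//; apply/funext => x; rewrite subr0.
have S0 : (0 <= mean_osc_sup mu BB r f B)%E.
  apply: (@le_trans _ _ (mean_osc mu r f B)); first exact: poweR_ge0.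
  by apply: ereal_sup_ubound; exists B => //; split.
have Sfin : (mean_osc_sup mu BB r f B < +oo)%E.
  apply: (@le_lt_trans _ _ (4 * (c + 2 * c))%:E); last exact: ltry.
  by apply: ge_ereal_sup => _ [C [BC BBC] <-]; exact: osc.
exists (fine (mean_osc_sup mu BB r f B)); split.
- exact: fine_ge0.
- by rewrite fineK// ge0_fin_numE.
- move=> C BBC BC; have [mC Cfin] := BBm _ BBC.
  apply/(mean_normP r1) => //; first exact: fine_ge0.
  rewrite fineK ?ge0_fin_numE//; apply: ereal_sup_ubound.
  by exists C.
Qed.
End Lr_mean_value.

(** * Balls *)

Section balls.
Context (d : measure_display) (X : measurableType d) (R : realType).
Context (mu : {measure set X -> \bar R}) (BB : set (set X)) (K eta : R).
Hypothesis hBB : ball_basis mu BB K.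
Implicit Types A B C P : set X.

Local Notation m A := (fine (mu A)).

Lemma ball_finite B : BB B -> measurable B /\ (0 < mu B < +oo)%E.
Proof.
move=> BBB; split; first exact: ball_measurable hBB _ BBB.
exact: ball_B1 hBB _ BBB.
Qed.

Lemma ball_fineK B : BB B -> ((m B)%:E = mu B)%E.
Proof.
by case/ball_finite => _ /andP[_ Bfin]; rewrite fineK// ge0_fin_numE.
Qed.

Lemma ball_fine_gt0 B : BB B -> 0 < m B.
Proof. by case/ball_finite => _; exact: fine_gt0. Qed.

Lemma ball_nonempty B : BB B -> B !=set0.
Proof.
move=> /ball_finite[_ /andP[B0 _]]; apply/set0P/negP => /eqP B_0.
by rewrite B_0 measure0 ltxx in B0.
Qed.

Lemma ball_fine_le A B : BB A -> BB B -> A `<=` B -> m A <= m B.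
Proof.
move=> bA bB AB; rewrite -lee_fin !ball_fineK//.
by rewrite le_measure ?inE//; case: (ball_finite bA); case: (ball_finite bB).
Qed.

Lemma sub_hull A B : BB A -> BB B -> m A <= 2 * m B -> A `&` B !=set0 ->
  A `<=` hull mu BB B.
Proof.
move=> bA bB AB nAB x Ax; exists A => //; split => //.
by rewrite -ball_fineK// -[mu B]ball_fineK// -EFinM lee_fin.
Qed.

Lemma ball_sub_hull B : BB B -> B `<=` hull mu BB B.
Proof.
move=> bB; apply: sub_hull => //; last by rewrite setIid; exact: ball_nonempty.
by rewrite ler_peMl ?ler1n// ltW// ball_fine_gt0.
Qed.

Lemma ball_enlarge B : BB B ->
  exists B1, [/\ BB B1, hull mu BB B `<=` B1 & m B1 <= K * m B].
Proof.
move=> bB; have [B1 [b1 hB1 mB1]] := ball_B4 hBB bB.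
by exists B1; split => //; rewrite -lee_fin EFinM !ball_fineK.
Qed.

Lemma ball_K_ge1 B : BB B -> 1 <= K.
Proof.
move=> bB; have [B1 [b1 hB1 mB1]] := ball_enlarge bB.
rewrite -(ler_pM2r (ball_fine_gt0 bB)) mul1r (le_trans _ mB1)//.
by apply: ball_fine_le => //; exact: subset_trans (ball_sub_hull bB) hB1.
Qed.

(** The smaller ball [C] meets [P], hence lies in its hull, and [P] contains both. *)
Lemma ball_union P C : BB P -> BB C -> m C <= m P -> C `&` P !=set0 ->
  exists D, [/\ BB D, P `<=` D, C `<=` D & m D <= K * m P].
Proof.
move=> bP bC CP nCP; have [D [bD hD mD]] := ball_enlarge bP.
exists D; split=> //; first exact: subset_trans (ball_sub_hull bP) hD.
apply: subset_trans hD; apply: sub_hull => //.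
by rewrite (le_trans CP)// ler_peMl ?ler1n// ltW// ball_fine_gt0.
Qed.

(** The two balls may be disjoint: by (B2) a third one meets both, and two successive unions absorb
    it. The measure of the result is not controlled. *)
Lemma ball_cover2 P C : BB P -> BB C -> exists D, [/\ BB D, P `<=` D & C `<=` D].
Proof.
move=> bP bC.
have meet Q Q' : BB Q -> BB Q' -> Q `&` Q' !=set0 ->
    exists D, [/\ BB D, Q `<=` D & Q' `<=` D].
  move=> bQ bQ' QQ'; have [QQ|/ltW QQ] := leP (m Q) (m Q').
    by have [D [bD ? ? _]] := ball_union bQ' bQ QQ QQ'; exists D.
  rewrite setIC in QQ'.
  by have [D [bD ? ? _]] := ball_union bQ bQ' QQ QQ'; exists D.
have [[x Px] [y Cy]] := (ball_nonempty bP, ball_nonempty bC).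
have [A [bA Ax Ay]] := ball_B2 hBB x y.
have [D [bD PD AD]] : exists D, [/\ BB D, P `<=` D & A `<=` D].
  by apply: meet => //; exists x.
have [E [bE DE CE]] : exists E, [/\ BB E, D `<=` E & C `<=` E].
  by apply: meet => //; exists y; split => //; exact: AD.
by exists E; split => //; exact: subset_trans DE.
Qed.

Hypothesis hdoubling : doubling_basis mu BB eta.

(* Doubling alone need not increase the measure; applied to P1 = [P], it yields
   a ball P' not included in P^*, so that 2 mu(P) < mu(P'). *)
Lemma ball_grow P : BB P ->
  (exists D, [/\ BB D, D = setT & m D <= K * (K * m P)]) \/
  (exists P', [/\ BB P', P `<=` P', 2 * m P <= m P' & m P' <= eta * K * m P]).
Proof.
move=> bP; have [P1 [b1 hP1 mP1]] := ball_enlarge bP.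
have PP1 := subset_trans (ball_sub_hull bP) hP1.
have [eta1 hd] := hdoubling.
have [h1|h1] := pselect (hull mu BB P1 = setT).
  (* Here [P1] is all of X, so X is itself a ball, of measure comparable to that of [P]. *)
  left; have [D [bD hD mD]] := ball_enlarge b1; exists D; split => //.
    by apply/seteqP; split => //; rewrite -h1.
  rewrite (le_trans mD)// ler_wpM2l// (le_trans _ (ball_K_ge1 bP))//.
right; have [P' [b' [P1P' nP] mP']] := hd _ b1 h1.
exists P'; split=> //.
- exact: subset_trans P1P'.
- rewrite leNgt; apply/negP => lt; apply: nP; apply: subset_trans hP1.
  apply: sub_hull => //; first exact: ltW.
  by have [x Px] := ball_nonempty bP; exists x; split => //; exact/P1P'/PP1.
- move: mP'; rewrite -ball_fineK// -[mu P1]ball_fineK// -EFinM lee_fin.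
  move=> /le_trans; apply; rewrite -mulrA ler_wpM2l//.
  by rewrite ltW// (lt_trans ltr01).
Qed.
End balls.

(** * Growth of the means *)

Section mean_growth.
Context (d : measure_display) (X : measurableType d) (R : realType).
Context (mu : {measure set X -> \bar R}) (BB : set (set X)) (K eta r : R).
Hypothesis r1 : 1 <= r.
Hypothesis hBB : ball_basis mu BB K.
Hypothesis hdoubling : doubling_basis mu BB eta.
Context (U : completeNormedModType R) (f : X -> U) (B : set X) (S : R).
Hypothesis mf : strongly_measurable f.
Hypothesis bB : BB B.
Hypothesis S0 : 0 <= S.
Hypothesis hS : forall C, BB C -> B `<=` C ->
  Lr_bound mu r C (fun x => f x - mean mu f C) S.
Implicit Types C P D : set X.

Local Notation m A := (fine (mu A)).
(** Bounds all ratios of measures met along a chain: [eta * K] for a link, and [K], [K * K] and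
    [K * (eta * K)] for the ball that closes it. *)
Local Notation Q := (eta * K * K).

Let strongly_measurable_sub (u : U) : strongly_measurable (fun x => f x - u).
Proof. by apply: strongly_measurableD => //; exact: strongly_measurable_cst. Qed.

Lemma mean_dist_subset C D (k : R) : BB C -> BB D -> B `<=` C -> C `<=` D ->
  1 <= k -> m D <= k * m C -> `|mean mu f C - mean mu f D| <= 2 * k * S.
Proof.
move=> bC bD BC CD k1 DC.
have [mC Cfin] := ball_finite hBB bC; have [mD _] := ball_finite hBB bD.
rewrite -mulrA; apply: (Lr_bound_mean_dist r1) => //.
  by rewrite mulr_ge0// (le_trans ler01).
exact: Lr_bound_subset DC (hS bD (subset_trans BC CD)).
Qed.

Lemma mean_dist_common C C' D (k : R) : BB C -> BB C' -> BB D -> B `<=` C ->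
  B `<=` C' -> C `<=` D -> C' `<=` D -> 1 <= k ->
  m D <= k * m C -> m D <= k * m C' ->
  `|mean mu f C - mean mu f C'| <= 2 * (2 * k * S).
Proof.
move=> bC bC' bD BC BC' CD C'D k1 DC DC'.
rewrite (le_trans (ler_distD (mean mu f D) _ _))// mulr_natl mulr2n lerD//.
  exact: mean_dist_subset.
by rewrite distrC; exact: mean_dist_subset.
Qed.

(** Induction on the number [n] of doublings after which [P] is at least as large as [C]. Each link
    to a larger ball costs one distance between means; closing the chain by a ball containing both
    [P] and [C] costs two, hence [n.+2]. The intermediate balls need not lie in [C], they only share
    [B] with it; the hypothesis [m P <= eta * K * m C] says that the last link overshoots [C] by a
    bounded factor. *)
Lemma mean_dist_chain (n : nat) P C : BB P -> BB C -> B `<=` P -> B `<=` C ->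
  m P <= eta * K * m C -> m C <= 2 ^+ n * m P ->
  `|mean mu f P - mean mu f C| <= n.+2%:R * (2 * Q * S).
Proof.
have K1 := ball_K_ge1 hBB bB; have K0 := le_trans ler01 K1.
have eta1 : 1 <= eta by case: hdoubling => /ltW.
have eta0 := le_trans ler01 eta1.
have M1 : 1 <= eta * K by rewrite -[1]mulr1 ler_pM.
have M0 := le_trans ler01 M1.
have KQ : K <= Q by rewrite ler_peMl.
have Q1 := le_trans K1 KQ; have Q0 := le_trans ler01 Q1.
have MQ : eta * K <= Q by rewrite ler_peMr.
have KKQ : K * K <= Q by rewrite ler_wpM2r// ler_peMl.
have QS0 : 0 <= 2 * Q * S by rewrite !mulr_ge0.
have two k : 2 * (2 * Q * S) <= k.+2%:R * (2 * Q * S).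
  by rewrite ler_wpM2r// ler_nat.
have meetBC P' : BB P' -> B `<=` P' -> B `<=` C -> C `&` P' !=set0.
  by have [x Bx] := ball_nonempty hBB bB; exists x; split; auto.
move=> bP bC BP BC PC CP; elim: n P bP BP PC CP => [|n IH] P bP BP PC CP.
(* If [P] is already as large as [C], the chain is closed at once, for [n = 0] as for a
   successor. *)
all: have [CP'|PC'] := leP (m C) (m P).
all: try (apply: le_trans (two _);
  have [D [bD PD CD mD]] := ball_union hBB bP bC CP' (meetBC _ bP BP BC);
  apply: (mean_dist_common bP bC bD) => //;
  [ by rewrite (le_trans mD)// ler_wpM2r ?fine_ge0
  | rewrite (le_trans mD)// (_ : Q * m C = K * (eta * K * m C)); last ring;
    exact: ler_wpM2l]).
  by move: PC'; rewrite ltNge -[m P]mul1r -(expr0 2) CP.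
have [[D [bD DT mD]]|[P' [bP' PP' P2P' mP']]] := ball_grow hBB hdoubling bP.
  apply: le_trans (two _); rewrite mulrA in mD.
  apply: (mean_dist_common bP bC bD) => //; rewrite ?DT// -?DT.
    by rewrite (le_trans mD)// ler_wpM2r ?fine_ge0.
  by rewrite (le_trans mD)// ler_pM ?mulr_ge0 ?fine_ge0// ltW.
(* One link: as [m P < m C], the larger ball [P'] still satisfies the overshoot condition, and
   doubling lowers the exponent by one. *)
rewrite (le_trans (ler_distD (mean mu f P') _ _))// -addn2 -addn1 addnAC.
rewrite natrD mulrDl mul1r addrC lerD// ?addn2.
  apply: IH => //; first exact: subset_trans PP'.
  - by rewrite (le_trans mP')// ler_wpM2l// ltW.
  - rewrite (le_trans CP)// exprSr -mulrA ler_wpM2l// exprn_ge0//.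
apply: (@le_trans _ _ (2 * (eta * K) * S)).
  exact: mean_dist_subset.
by rewrite ler_wpM2r// ler_wpM2l.
Qed.

Lemma mean_dist_log C : BB C -> B `<=` C ->
  `|mean mu f B - mean mu f C| <=
  8 * Q / ln 2 * ln (1 + m C / m B) * S.
Proof.
move=> bC BC; have mB0 := ball_fine_gt0 hBB bB.
have K1 := ball_K_ge1 hBB bB; have K0 := le_trans ler01 K1.
have eta1 : 1 <= eta by case: hdoubling => /ltW.
have eta0 := le_trans ler01 eta1.
have M1 : 1 <= eta * K by rewrite -[1]mulr1 ler_pM.
set t := m C / m B.
have t1 : 1 <= t by rewrite ler_pdivlMr// mul1r (ball_fine_le hBB).
have mCE : m C = t * m B by rewrite divfK// gt_eqF.
have l2 : 0 < ln 2 :> R by rewrite ln_gt0// ltr1n.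
have l2t : ln 2 <= ln (1 + t).
  by rewrite ler_ln ?posrE ?ltr_wpDr ?(le_trans ler01 t1)// -[2]natr1 addrC lerD2l.
have ex : exists n, (t <= 2 ^+ n).
  exists (Num.truncn t).+1; apply: ltW; apply: lt_trans (truncnS_gt t) _.
  by rewrite -natrX ltr_nat ltn_expl.
case: (ex_minnP ex) => n tn nmin.
(* For n = k + 1, minimality gives 2^k <= t, so that k ln 2 <= ln (1 + t); the remaining 3 ln 2 is
   at most 3 ln (1 + t), as t >= 1. *)
have nt : n.+2%:R * ln 2 <= 4 * ln (1 + t).
  case: n tn nmin => [|n] tn nmin; first by lra.
  have tn' : 2 ^+ n <= t.
    by rewrite leNgt; apply/negP => /ltW /nmin; rewrite ltnn.
  have : ln (2 ^+ n) <= ln (1 + t).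
    rewrite ler_ln ?posrE ?exprn_gt0// ?ltr_wpDr ?(le_trans ler01 t1)//.
    by rewrite (le_trans tn')// lerDr.
  rewrite lnXn// -[n.+3]addn3 natrD (mulrDl n%:R) mulr_natl => h.
  by lra.
apply: (@le_trans _ _ (n.+2%:R * (2 * Q * S))).
  apply: mean_dist_chain => //.
  - by rewrite (le_trans (ball_fine_le hBB bB bC BC))// ler_peMl// fine_ge0.
  - by rewrite mCE ler_wpM2r// ltW.
rewrite mulrA ler_wpM2r// (_ : 8 * Q / ln 2 * ln (1 + t) =
  4 * ln (1 + t) / ln 2 * (2 * Q)); last by field; rewrite gt_eqF.
by rewrite ler_wpM2r ?mulr_ge0// ler_pdivlMr.
Qed.

(** On [C], f - f_B is the sum of f - f_C, bounded by [S], and of a constant bounded by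
    [mean_dist_log]. The factor 4 is that of [Lr_boundD], and the 1 in [1 + 8 * Q] is the first
    term, absorbed into the logarithm by [ln 2 <= ln (1 + m C / m B)]. *)
Lemma Lr_bound_log C : BB C -> B `<=` C ->
  Lr_bound mu r C (fun x => f x - mean mu f B)
    (4 * (1 + 8 * Q) / ln 2 * ln (1 + m C / m B) * S).
Proof.
move=> bC BC; have mB0 := ball_fine_gt0 hBB bB.
have [mC Cfin] := ball_finite hBB bC.
have K1 := ball_K_ge1 hBB bB; have K0 := le_trans ler01 K1.
have eta0 : 0 <= eta by case: hdoubling => /ltW /(le_trans ler01).
have l2 : 0 < ln 2 :> R by rewrite ln_gt0// ltr1n.
have l2t : ln 2 <= ln (1 + m C / m B).
  rewrite ler_ln ?posrE ?ltr_wpDr ?divr_ge0 ?fine_ge0// -[2]natr1 addrC lerD2l.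
  by rewrite ler_pdivlMr// mul1r (ball_fine_le hBB).
have CB := mean_dist_log bC BC.
have -> : (fun x => f x - mean mu f B) =
    (fun x => f x - mean mu f C + (mean mu f C - mean mu f B)).
  by apply/funext => x; rewrite addrA subrK.
set c := 8 * Q / ln 2 * ln (1 + m C / m B) * S in CB.
have c0 : 0 <= c by exact: le_trans CB.
have cst : Lr_bound mu r C (fun=> mean mu f C - mean mu f B) c.
  apply: Lr_bound_le (Lr_bound_cst _ _ mC _) => //; last by case/andP: Cfin.
  by rewrite distrC.
have := Lr_boundD r1 mC _ (strongly_measurable_cst _ _) S0 c0 (hS bC BC) cst.
move=> /(_ (strongly_measurable_sub _)); apply: Lr_bound_le => //.
  by rewrite mulr_ge0// addr_ge0.
rewrite -[4 * _ / _ * _ * _]mulrA -[4 * _ / _ * _]mulrA -[4 * _ * _]mulrA.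
rewrite ler_wpM2l// [leRHS]mulrC.
rewrite (_ : _ * (1 + 8 * Q) = (ln 2)^-1 * (ln (1 + m C / m B)) * S + c); last first.
  by rewrite /c; ring.
by rewrite lerD2r ler_peMl// ler_pdivlMl// mulr1.
Qed.
End mean_growth.

(** * Essential oscillation and maximal operators *)

Section oscillation.
Context (d : measure_display) (X : measurableType d) (R : realType).
Context (mu : {measure set X -> \bar R}).
Implicit Types (A B E : set X) (b c e : R).

Lemma ae_setI_nonempty B (P : set X) : measurable B -> (0 < mu B)%E ->
  (\forall x \ae mu, B x -> P x) -> exists2 x, B x & P x.
Proof.
move=> mB B0 aeP; apply: contrapT => nP.
suff : mu B = 0 by move=> B_0; rewrite B_0 ltxx in B0.
apply: (measure_negligible mB); apply: negligibleS aeP => x Bx /= /(_ Bx) Px.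
by apply: nP; exists x.
Qed.

Section normed.
Context (V : normedModType R).
Implicit Types F G : X -> V.

(** A real bound and a single conull set for both variables, which sums and triangle inequalities
    handle easily. It implies the bound on [OSC], and follows from it up to an arbitrary [e], [OSC]
    being an infimum. *)
Definition ae_osc_le E F c : Prop := exists2 P : set X, (\forall x \ae mu, P x) &
  forall x y, P x -> P y -> E x -> E y -> `|F x - F y| <= c.

Lemma ae_osc_leP E F c : ae_osc_le E F c -> (OSC mu E F <= c%:E)%E.
Proof.
move=> [P aeP Pc]; apply: ereal_inf_lbound; exists (P, P) => //= -[x y] [/= Px Py].
by move=> Ex Ey; rewrite lee_fin; exact: Pc.
Qed.

Lemma OSC_ae_osc_le E F c e : (OSC mu E F <= c%:E)%E -> 0 < e ->
  ae_osc_le E F (c + e).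
Proof.
move=> oc e0; have : (OSC mu E F < (c + e)%:E)%E.
  by apply: le_lt_trans oc _; rewrite lte_fin ltrDl.
move=> /ereal_inf_lt[z [[P Q] [/= aeP aeQ] PQ] zc].
exists (P `&` Q); first exact: filterI.
move=> x y [Px _] [_ Qy] Ex Ey; rewrite -lee_fin.
exact: le_trans (PQ (x, y) (conj Px Qy) Ex Ey) (ltW zc).
Qed.

Lemma ae_osc_le_ae E F G c : (\forall x \ae mu, F x = G x) ->
  ae_osc_le E F c -> ae_osc_le E G c.
Proof.
move=> FG [P aeP Pc]; exists (P `&` [set x | F x = G x]); first exact: filterI.
by move=> x y [Px /= <-] [Py /= <-]; exact: Pc.
Qed.

Lemma ae_osc_leD E F G a b : ae_osc_le E F a -> ae_osc_le E G b ->
  ae_osc_le E (fun x => F x + G x) (a + b).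
Proof.
move=> [P aeP Pa] [Q aeQ Qb]; exists (P `&` Q); first exact: filterI.
move=> x y [Px Qx] [Py Qy] Ex Ey; rewrite opprD addrACA.
by rewrite (le_trans (ler_normD _ _))// lerD//; [exact: Pa|exact: Qb].
Qed.

Lemma ae_osc_le_le E F a b : a <= b -> ae_osc_le E F a -> ae_osc_le E F b.
Proof.
move=> ab [P aeP Pa]; exists P => // x y Px Py Ex Ey.
exact: le_trans (Pa _ _ Px Py Ex Ey) ab.
Qed.
End normed.

Section maximal.
Context (r : R) (U V : normedModType R) (I : Type).
Context (Tf : I -> (X -> U) -> X -> V) (T : (X -> U) -> X -> R).
Hypothesis maxT : maximal_operator mu r Tf T.

Let nat_unbounded (y : R) : exists n : nat, y < n%:R.
Proof. by exists (Num.truncn y).+1; exact: truncnS_gt. Qed.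

(* The lattice supremum of an empty family would be - oo. *)
Lemma maximal_operator_inhabited B (h : X -> U) : measurable B -> (0 < mu B)%E ->
  in_Lr mu r h -> exists a : I, True.
Proof.
move=> mB B0 hL; apply: contrapT => nI.
have [_ _ Tmin] := maxT hL.
have : \forall x \ae mu, forall n, T h x <= - n%:R.
  by apply: ae_foralln => n; apply: Tmin => // a; case: nI; exists a.
move=> Tn; have [|x Bx Tx] :=
  @ae_setI_nonempty B (fun x => forall n, T h x <= - n%:R) mB B0.
  by apply: filterS Tn.
have [n] := nat_unbounded (- T h x).
by rewrite ltrNl ltNge Tx.
Qed.

(* The common lower bound M of the |T_a h| on B, up to the oscillation, is also
   one of T h, and M + c is a majorant of all of them. *)
Lemma maximal_ae_osc_le B (h : X -> U) c e : measurable B -> (0 < mu B)%E ->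
  in_Lr mu r h -> (forall a, ae_osc_le B (Tf a h) c) -> 0 < e ->
  ae_osc_le B (T h : X -> R^o) (c + e).
Proof.
move=> mB B0 hL oscT e0; have [mT Tmaj Tmin] := maxT hL.
have [a0 _] := maximal_operator_inhabited mB B0 hL.
pose L := [set q : R | exists a, \forall x \ae mu, B x -> q <= `|Tf a h x|].
have L0 : L 0 by exists a0; apply: nearW.
have LT q : L q -> \forall x \ae mu, B x -> q <= T h x.
  move=> [a qa]; near=> x => Bx; apply: (@le_trans _ _ `|Tf a h x|).
    by move: Bx; near: x.
  by near: x; exact: Tmaj.
have supL : has_sup L.
  split; first by exists 0.
  (* If [L] were unbounded, [T h] would exceed every integer at some point of [B]. *)
  apply: contrapT => unb.
  have Ln (n : nat) : \forall x \ae mu, B x -> n%:R <= T h x.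
    have [q Lq nq] : exists2 q, L q & n%:R < q.
      apply: contrapT => nq; apply: unb; exists n%:R => q Lq.
      by rewrite leNgt; apply/negP => lt; apply: nq; exists q.
    apply: filterS (LT q Lq) => x qx /qx; exact/le_trans/ltW.
  have [|x Bx Tx] := @ae_setI_nonempty B (fun x => forall n, n%:R <= T h x) mB B0.
    by apply: filterS (ae_foralln Ln) => x nx Bx n; exact: nx.
  have [n] := nat_unbounded (T h x).
  by rewrite ltNge Tx.
set M := sup L.
have Tlow : \forall x \ae mu, B x -> M - e <= T h x.
  have [q Lq Mq] := sup_adherent e0 supL.
  by apply: filterS (LT q Lq) => x qx /qx; exact/le_trans/ltW.
have Tupp : \forall x \ae mu, B x -> T h x <= M + c.
  (* Minimality of [T h] concerns majorants on all of X, so the local majorant [M + c] is completed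
     by [T h] itself off [B]. *)
  pose H x := \1_B x * (M + c) + \1_(~` B) x * T h x.
  have mH : measurable_fun setT H.
    by apply: measurable_funD; apply: measurable_funM => //;
      apply: measurable_indic => //; exact: measurableC.
  have HB x : B x -> H x = M + c.
    by move=> Bx; rewrite /H !indicE in_setC mem_set// mul1r mul0r addr0.
  have HnB x : ~ B x -> H x = T h x.
    by move=> nBx; rewrite /H !indicE in_setC memNset// mul0r mul1r add0r.
  have /(Tmin _ mH) : forall a, \forall x \ae mu, `|Tf a h x| <= H x.
    move=> a; have [P aeP Pc] := oscT a.
    apply: filterS2 (aeP) (Tmaj a) => x Px Tx.
    have [Bx|nBx] := pselect (B x); last by rewrite HnB.
    (* At a good point [x], the number [|Tf a h x| - c] is a lower bound of [|Tf a h|] almost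
       everywhere on [B], so it belongs to [L]. *)
    rewrite HB// -lerBlDr; apply: (ub_le_sup supL.2).
    exists a; apply: filterS aeP => y Py By; rewrite lerBlDr -lerBlDl.
    by rewrite (le_trans (lerB_dist _ _))// Pc.
  by apply: filterS => x Hx Bx; rewrite -(HB x Bx).
exists [set x | (B x -> M - e <= T h x) /\ (B x -> T h x <= M + c)].
  exact: filterI.
move=> x y [lx ux] [ly uy] Bx By.
move: (lx Bx) (ux Bx) (ly By) (uy By) => {}lx {}ux {}ly {}uy.
by rewrite ler_norml; apply/andP; split; lra.
Unshelve. all: by end_near. Qed.
End maximal.
End oscillation.

(** * Tails of L^r functions outside large balls *)

Section exhaustion.
Context (d : measure_display) (X : measurableType d) (R : realType).
Context (mu : {measure set X -> \bar R}) (BB : set (set X)) (K r : R).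
Hypothesis hBB : ball_basis mu BB K.

Lemma ball_cover_finite (D : set nat) (F : nat -> set X) (B : set X) (n : nat) :
  (forall k, D k -> BB (F k)) -> BB B -> exists C, [/\ BB C, B `<=` C &
    forall k, (k < n)%N -> D k -> F k `<=` C].
Proof.
move=> DF bB; elim: n => [|n [C [bC BC FC]]]; first by exists B; split.
have [Dn|nDn] := pselect (D n); last first.
  exists C; split => // k; rewrite ltnS leq_eqVlt => /orP[/eqP -> //|]; exact: FC.
have [C' [bC' CC' FC']] := ball_cover2 hBB bC (DF n Dn).
exists C'; split => //; first exact: subset_trans CC'.
move=> k; rewrite ltnS leq_eqVlt => /orP[/eqP -> //|kn Dk].
exact: subset_trans (FC k kn Dk) CC'.
Qed.

(** (B3) covers X by balls only up to a set of small measure, over which the integral is small by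
    absolute continuity. Monotone convergence then leaves finitely many of these balls, and one ball
    contains them all. *)
Lemma ball_exhaust (U : normedModType R) (f : X -> U) (B : set X) (e : R) :
  in_Lr mu r f -> BB B -> 0 < e -> exists C, [/\ BB C, B `<=` C &
    (\int[mu]_(x in ~` C) (`|f x| `^ r)%:E < e%:E)%E].
Proof.
move=> fL bB e0; have [mf ff] := fL.
have e20 : 0 < e / 2 by rewrite divr_gt0.
pose g x := `|f x| `^ r.
have g0 x : 0 <= g x by exact: powR_ge0.
have mg A : measurable_fun A (fun x => (g x)%:E) by exact: measurable_powR_norm.
have ig : mu.-integrable setT (EFin \o g).
  apply/integrableP; split; first exact: mg.
  by under eq_integral do rewrite /= ger0_norm//.
have [dl [dl0 hdl]] := integral_normr_continuous ig e20.
have [D [F [DF mW]]] := ball_B3 hBB measurableT dl0.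
set W := \bigcup_(k in D) F k in mW; rewrite setTYC in mW.
have mF k : D k -> measurable (F k) by move=> /DF /(ball_finite hBB)[].
have mWW : measurable W by apply: bigcup_measurable => k; exact: mF.
have mnW : measurable (~` W) by exact: measurableC.
pose F' n := \bigcup_(k in [set k | D k /\ (k < n)%N]) F k.
have mF' n : measurable (F' n) by apply: bigcup_measurable => k [Dk _]; exact: mF.
(* Adding the uncovered set makes the union all of X, so that the integrals over [G n] tend to the
   full one. *)
pose G n := F' n `|` ~` W.
have mG n : measurable (G n) by exact: measurableU.
have ndG : nondecreasing_seq G.
  move=> n n' nn'; apply/subsetPset; apply: setSU => x [k [Dk kn] Fx].
  by exists k => //; split => //; exact: leq_trans nn'.
have GT : \bigcup_n G n = setT.
  apply/seteqP; split => // x _; have [[k Dk Fx]|nW] := pselect (W x).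
    by exists k.+1 => //; left; exists k.
  by exists 0%N => //; right.
have cG := ge0_nondecreasing_set_cvg_integral (mu := mu) ndG mG
  (fun n => mg (G n)) (fun n x _ => g0 x).
rewrite GT in cG.
have J0 A : (0 <= \int[mu]_(x in A) (g x)%:E)%E by apply: integral_ge0 => x _; exact: g0.
have Jfin A : measurable A -> (\int[mu]_(x in A) (g x)%:E \is a fin_num)%E.
  by move=> mA; rewrite ge0_fin_numE//; exact: in_Lr_integral_lty.
have JS A A' : measurable A -> measurable A' -> A `<=` A' ->
    (\int[mu]_(x in A) (g x)%:E <= \int[mu]_(x in A') (g x)%:E)%E.
  by move=> mA mA' AA'; apply: ge0_subset_integral => // x _; exact: g0.
have JU A A' : measurable A -> measurable A' -> A `&` A' = set0 ->
    (\int[mu]_(x in A `|` A') (g x)%:E =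
     \int[mu]_(x in A) (g x)%:E + \int[mu]_(x in A') (g x)%:E)%E.
  move=> mA mA' AA'; apply: ge0_integral_setU => //; first by move=> x _; exact: g0.
  by apply/disj_setPS; rewrite AA'.
have [n Gn] : exists n, (\int[mu]_(x in ~` G n) (g x)%:E < (e / 2)%:E)%E.
  have [n h] : exists n, (\int[mu]_x (g x)%:E - (e / 2)%:E <
      \int[mu]_(x in G n) (g x)%:E)%E.
    apply: contrapT => nh; suff : (\int[mu]_x (g x)%:E <=
        \int[mu]_x (g x)%:E - (e / 2)%:E)%E.
      rewrite leNgt => /negP; apply.
      by rewrite lteBlDr// lteDl ?Jfin// lte_fin.
    rewrite -{1}(cvg_lim _ cG)//; apply: lime_le.
      by apply/cvg_ex; eexists; exact: cG.
    by apply: nearW => n; rewrite leNgt; apply/negP => lt; apply: nh; exists n.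
  exists n; move: h.
  rewrite -(setUv (G n)) JU ?setICr//; last exact: measurableC.
  rewrite lteBlDr// addeC [ltRHS]addeC lteD2rE//.
  exact: Jfin.
have [C [bC BC FC]] := ball_cover_finite n DF bB.
have [mC _] := ball_finite hBB bC.
exists C; split => //; have mnC : measurable (~` C) by exact: measurableC.
have mnG : measurable (~` G n) by exact: measurableC.
apply: (@le_lt_trans _ _ (\int[mu]_(x in ~` G n `|` ~` W) (g x)%:E)%E).
  apply: JS => //; first exact: measurableU.
  move=> x nCx; have [Wx|nWx] := pselect (W x); last by right.
  by left => -[[k [Dk kn] Fx]|//]; apply: nCx; exact: (FC k kn Dk).
rewrite JU//; last first.
  by apply/seteqP; split => // x [nG nW]; apply: nG; right.
rewrite [e]splitr EFinD; apply: lteD => //.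
have := hdl _ mnW mW; rewrite /Rintegral.
under eq_integral do rewrite ger0_norm//.
by rewrite -lte_fin fineK// Jfin.
Qed.
End exhaustion.

(** * Consequences of (R2), (R4) and (T0) for one operator and for the maximal one *)

Section operators.
Context (d : measure_display) (X : measurableType d) (R : realType).
Context (mu : {measure set X -> \bar R}) (BB : set (set X)) (K r : R).
Hypothesis r1 : 1 <= r.
Hypothesis hBB : ball_basis mu BB K.
Context (U V : normedModType R).

Local Notation m A := (fine (mu A)).

Lemma R2_add (Op : (X -> U) -> X -> V) (p q : X -> U) : R2 mu r Op ->
  in_Lr mu r p -> in_Lr mu r q ->
  \forall x \ae mu, Op (fun y => p y + q y) x = Op p x + Op q x.
Proof.
move=> /(_ 1 p q) h pL qL; move: (h pL qL).
rewrite (_ : (fun y => 1 *: p y + q y) = (fun y => p y + q y)); last first.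
  by apply/funext => y; rewrite scale1r.
by apply: filterS => x; rewrite scale1r.
Qed.

Lemma R4_OSC (Op : (X -> U) -> X -> V) (L1 w : R) (B : set X) (h : X -> U) :
  R4 mu BB r Op L1 -> in_Lr mu r h -> BB B -> 0 <= w ->
  (forall C, BB C -> B `<=` C -> Lr_bound mu r C h (w * ln (1 + m C / m B))) ->
  (OSC mu B (Op (cutoff (~` hull mu BB B) h)) <= (L1 * w)%:E)%E.
Proof.
move=> [L10 r4] hL bB w0 hw; apply: le_trans (r4 h hL B bB) _.
rewrite EFinM; apply: lee_wpmul2l; first by rewrite lee_fin.
apply: ge_ereal_sup => _ [C [bC BC] <-].
have lt0 : 0 < ln (1 + m C / m B).
  by rewrite ln_gt0// ltrDl divr_gt0// (ball_fine_gt0 hBB).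
have [_ Cfin] := ball_finite hBB bC.
have := hw C bC BC; move/(mean_normP r1 _ Cfin (mulr_ge0 w0 (ltW lt0))).
move=> /(@lee_wpmul2l _ (ln (1 + m C / m B))^-1%:E) h1.
apply: le_trans (h1 _) _; first by rewrite lee_fin invr_ge0 ltW.
by rewrite -EFinM lee_fin mulrCA mulVf ?mulr1// gt_eqF.
Qed.

(** A sum of maximal functions majorizes each [|T_a|] almost everywhere, hence also the least
    majorant. For the lower bound, [T_a q = T_a (p + q) - T_a p] is used, so that no value of [T] at
    [- p] is needed. *)
Lemma maximal_operator_dist (I : Type) (Tf : I -> (X -> U) -> X -> V)
    (T : (X -> U) -> X -> R) (p q : X -> U) :
  maximal_operator mu r Tf T -> (forall a, R2 mu r (Tf a)) ->
  in_Lr mu r p -> in_Lr mu r q ->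
  \forall x \ae mu, `|T (fun y => p y + q y) x - T q x| <= T p x.
Proof.
move=> maxT r2 pL qL; have pqL := in_LrD r1 pL qL.
have [mp pmaj _] := maxT _ pL; have [mq qmaj qmin] := maxT _ qL.
have [mpq pqmaj pqmin] := maxT _ pqL.
have up : \forall x \ae mu, T (fun y => p y + q y) x <= T p x + T q x.
  apply: pqmin; first exact: measurable_funD.
  move=> a; apply: filterS3 (R2_add (r2 a) pL qL) (pmaj a) (qmaj a) => x -> px qx.
  by rewrite (le_trans (ler_normD _ _))// lerD.
have lo : \forall x \ae mu, T q x <= T p x + T (fun y => p y + q y) x.
  apply: qmin; first exact: measurable_funD.
  move=> a; apply: filterS3 (R2_add (r2 a) pL qL) (pmaj a) (pqmaj a).
  move=> x E px pqx; rewrite -[Tf a q x](addKr (Tf a p x)) -E.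
  by rewrite (le_trans (ler_normD _ _))// normrN lerD.
apply: filterS2 up lo => x ux lx; rewrite ler_norml; apply/andP; split; lra.
Qed.

Lemma measurable_norm_gt (g : X -> R) (c : R) : measurable_fun setT g ->
  measurable [set x | (c < `|g x|)%R].
Proof.
move=> mg; have mn : measurable_fun setT (fun x => `|g x|).
  exact: measurableT_comp.
have := mn measurableT _ (measurable_itv `]c, +oo[); rewrite setTI.
by congr measurable; apply/seteqP; split => x /=; rewrite in_itv/= ?andbT.
Qed.

Lemma T0_exceptional (T : (X -> U) -> X -> R^o) (L0 lambda : R) (A : set X)
    (h : X -> U) (w : R) :
  T0 mu BB r T L0 -> in_Lr mu r h -> measurable_fun setT (T h) ->
  BB A -> cutoff A h = h -> 0 < lambda -> 0 <= w -> Lr_bound mu r A h w ->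
  (mu (A `&` [set x | (lambda * w < `|T h x|)%R])
     <= ((L0 / lambda) `^ r * m A)%:E)%E.
Proof.
move=> [L00 t0] hL mT bA hA l0 w0 hw; have [mA Afin] := ball_finite hBB bA.
have := t0 h hL A bA lambda l0; rewrite hA => h1.
have := hw; move/(mean_normP r1 _ Afin w0) => nw.
rewrite EFinM (ball_fineK hBB bA); apply: le_trans h1.
have nfin : (mean_norm mu r h A \is a fin_num)%E.
  rewrite ge0_fin_numE; last exact: poweR_ge0.
  by apply: le_lt_trans nw _; rewrite ltry.
have mlt c : measurable [set x | (c < `|T h x|)%R] by exact: measurable_norm_gt.
have -> : [set x | (lambda%:E * mean_norm mu r h A < (`|T h x|)%:E)%E] =
    [set x | (lambda * fine (mean_norm mu r h A) < `|T h x|)%R].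
  by apply/seteqP; split => x /=; rewrite -lte_fin EFinM fineK.
apply: le_measure; rewrite ?inE; try exact: measurableI.
move=> x [Ax /= lx]; split => //=; apply: le_lt_trans lx.
by rewrite ler_wpM2l ?(ltW l0)// -lee_fin fineK.
Qed.
End operators.

(** * The estimate *)

Section far_part.
Context (d : measure_display) (X : measurableType d) (R : realType).
Context (mu : {measure set X -> \bar R}) (BB : set (set X)) (K eta r : R).
Hypothesis r1 : 1 <= r.
Hypothesis hBB : ball_basis mu BB K.
Hypothesis hsep : separable_basis BB.
Hypothesis hdoubling : doubling_basis mu BB eta.

Local Notation m A := (fine (mu A)).

Definition growth_constant : R := 4 * (1 + 8 * (eta * K * K)) / ln 2.

Lemma measurable_hull B : measurable (hull mu BB B).
Proof. by apply: hsep => A []. Qed.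

Lemma in_Lr_cutoff_sub (U : normedModType R) (f : X -> U) (u : U)
    (A : set X) :
  measurable A -> (mu A < +oo)%E -> in_Lr mu r f -> in_Lr mu r (cutoff A (fun x => f x - u)).
Proof.
move=> mA fA fL.
rewrite (_ : cutoff A _ = fun x => cutoff A f x + cutoff A (fun=> - u) x).
  exact: (in_LrD r1 (in_Lr_cutoff r1 mA fL) (in_Lr_cutoff_cst r1 (- u) mA fA)).
by apply/funext => x; rewrite /cutoff -scalerDr.
Qed.

Lemma Lr_bound_cutoff (U : normedModType R) (A C : set X)
    (h : X -> U) (c : R) :
  measurable A -> measurable C -> strongly_measurable h -> Lr_bound mu r C h c ->
  Lr_bound mu r C (cutoff A h) c.
Proof.
move=> mA mC mh; apply: le_trans; rewrite integral_powR_norm_cutoff//.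
apply: ge0_subset_integral => //; first exact: measurableI.
exact: measurable_powR_norm.
Qed.

Lemma far_part_osc (W : completeNormedModType R) (V : normedModType R)
    (Op : (X -> W) -> X -> V)
    (L1 : R) (f : X -> W) (B : set X) (S e : R) :
  R2 mu r Op -> R4 mu BB r Op L1 -> R5 mu BB Op -> in_Lr mu r f -> BB B ->
  0 <= S -> (forall C, BB C -> B `<=` C ->
    Lr_bound mu r C (fun x => f x - mean mu f C) S) -> 0 < e ->
  ae_osc_le mu B
    (Op (fun x => f x - cutoff (hull mu BB B) (fun x => f x - mean mu f B) x))
    (L1 * (growth_constant * S) + e).
Proof.
move=> r2 r4 r5 fL bB S0 hS e0; have mf := fL.1.
set u := mean mu f B; set H := hull mu BB B.
have mB0 := ball_fine_gt0 hBB bB; have mH : measurable H by exact: measurable_hull.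
have K1 := ball_K_ge1 hBB bB.
have eta1 : 0 <= eta by case: hdoubling => /ltW /(le_trans ler01).
have l2 : 0 < ln 2 :> R by rewrite ln_gt0// ltr1n.
have [L10 _] := r4.
(* One share for the main term, two for the tail of [f] and two for the constant: each [OSC] bound
   loses one when turned into [ae_osc_le]. *)
have e50 : 0 < e / 5 by rewrite divr_gt0.
(* [s] is such that [L1 * s <= e / 5], including when [L1] is 0. *)
pose s := e / 5 / (L1 + 1).
have s0 : 0 < s by rewrite divr_gt0// ltr_wpDl.
have L1s : L1 * s <= e / 5.
  by rewrite /s mulrCA ler_piMr ?(ltW e50)// ler_pdivrMr ?mul1r ?lerDl// ltr_wpDl.
clearbody s.
have c0 : 0 <= growth_constant.
  have K0 := le_trans ler01 K1.
  by rewrite /growth_constant divr_ge0 ?mulr_ge0 ?addr_ge0 ?mulr_ge0 ?(ltW l2).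
(* If the tail integral is below this threshold, the mean of the tail over any ball [D] containing
   [B] is at most [s * ln 2], hence at most [s * ln (1 + m D / m B)], as [R4_OSC] requires. *)
have t0 : 0 < (s * ln 2) `^ r * m B by rewrite mulr_gt0// powR_gt0// mulr_gt0.
have [B1 [b1 HB1 _]] := ball_enlarge hBB bB.
have [B' [b' BB' hB']] := r5 u B (e / 5) bB e50.
have [C0 [bC0 B1C0 B'C0]] := ball_cover2 hBB b1 b'.
have [C [bC C0C fC]] := ball_exhaust hBB fL bC0 t0.
have [mC Cfin] := ball_finite hBB bC.
have Cf : (mu C < +oo)%E by case/andP: Cfin.
have mnC : measurable (~` C) by exact: measurableC.
have mnH : measurable (~` H) by exact: measurableC.
have HC : H `<=` C by exact: subset_trans HB1 (subset_trans B1C0 C0C).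
have B'C : B' `<=` C by exact: subset_trans B'C0 C0C.
pose g x := f x - u.
have gL := in_Lr_cutoff_sub u mC Cf fL.
have nfL := in_Lr_cutoff r1 mnC fL.
have mg : strongly_measurable g.
  by apply: strongly_measurableD => //; exact: strongly_measurable_cst.
have osc1 : ae_osc_le mu B (Op (cutoff (~` H) (cutoff C g)))
    (L1 * (growth_constant * S) + e / 5).
  apply: OSC_ae_osc_le => //.
  apply: (R4_OSC r1 hBB r4 gL bB (mulr_ge0 c0 S0)) => D bD BD.
  have [mD _] := ball_finite hBB bD.
  apply: Lr_bound_cutoff => //.
  rewrite mulrAC; exact: (Lr_bound_log r1 hBB hdoubling mf bB S0 hS bD BD).
have osc2 : ae_osc_le mu B (Op (cutoff (~` H) (cutoff (~` C) f)))
    (L1 * s + e / 5).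
  apply: OSC_ae_osc_le => //.
  apply: (R4_OSC r1 hBB r4 nfL bB (ltW s0)) => D bD BD.
  have [mD _] := ball_finite hBB bD.
  rewrite /Lr_bound integral_powR_norm_cutoff//.
  apply: (@le_trans _ _ (\int[mu]_(x in ~` C) (`|f x| `^ r)%:E)%E).
    apply: ge0_subset_integral => //; first exact: measurableI.
    exact: measurable_powR_norm.
  apply: le_trans (ltW fC) _; rewrite lee_fin.
  have BDle := ball_fine_le hBB bB bD BD.
  have l2t : ln 2 <= ln (1 + m D / m B).
    rewrite ler_ln ?posrE ?ltr_wpDr ?divr_ge0 ?fine_ge0// -[2]natr1 addrC lerD2l.
    by rewrite ler_pdivlMr// mul1r.
  apply: ler_pM => //; rewrite ?powR_ge0 ?fine_ge0//.
  apply: ge0_ler_powR; rewrite ?nnegrE ?mulr_ge0 ?(ltW s0) ?(ltW l2)//.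
  - exact: le_trans r1.
  - by rewrite (le_trans (ltW l2)).
  - by rewrite ler_wpM2l ?(ltW s0).
have osc3 : ae_osc_le mu B (Op (cutoff C (fun=> u))) (e / 5 + e / 5).
  by apply: OSC_ae_osc_le => //; exact: hB'.
have h1L := in_Lr_cutoff r1 mnH gL.
have h2L := in_Lr_cutoff r1 mnH nfL.
have h3L := in_Lr_cutoff_cst r1 u mC Cf.
have decomp : (fun x => f x - cutoff H (fun x => f x - u) x) = (fun x =>
    cutoff (~` H) (cutoff C g) x +
    (cutoff (~` H) (cutoff (~` C) f) x + cutoff C (fun=> u) x)).
  apply/funext => x; rewrite /cutoff !indicE !in_setC /g.
  have [Hx|nHx] := boolP (x \in H).
    by rewrite (mem_set (HC x (set_mem Hx))) /= !scale1r !scale0r !add0r subKr.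
  have [Cx|nCx] := boolP (x \in C).
    by rewrite /= !scale1r !scale0r subr0 add0r subrK.
  by rewrite /= !scale1r !scale0r subr0 add0r addr0.
have D23 := ae_osc_leD osc2 osc3.
have A23 := R2_add r2 h2L h3L.
have E23 : ae_osc_le mu B (Op (fun x =>
    cutoff (~` H) (cutoff (~` C) f) x + cutoff C (fun=> u) x))
    (L1 * s + e / 5 + (e / 5 + e / 5)).
  by apply: ae_osc_le_ae D23; apply: filterS A23 => x ->.
have D123 := ae_osc_leD osc1 E23.
have A123 := R2_add r2 h1L (in_LrD r1 h2L h3L).
rewrite decomp; apply: (@ae_osc_le_le _ _ _ _ _ _ _ _ _ _ (ae_osc_le_ae _ D123)).
  by lra.
by apply: filterS A123 => x ->.
Qed.
End far_part.

(** * The part of f near B, and the oscillation of the maximal function *)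

Section near_part.
Context (d : measure_display) (X : measurableType d) (R : realType).
Context (mu : {measure set X -> \bar R}) (BB : set (set X)) (K eta r : R).
Hypothesis r1 : 1 <= r.
Hypothesis hBB : ball_basis mu BB K.
Hypothesis hsep : separable_basis BB.
Hypothesis hdoubling : doubling_basis mu BB eta.
Context (U : completeNormedModType R) (V : normedModType R).

Local Notation m A := (fine (mu A)).
Local Notation c1 := (growth_constant K eta).

Lemma growth_constant_ge0 (B : set X) : BB B -> 0 <= c1.
Proof.
move=> /(ball_K_ge1 hBB)/(le_trans ler01) K0.
have eta1 : 0 <= eta by case: hdoubling => /ltW /(le_trans ler01).
have l2 : 0 < ln 2 :> R by rewrite ln_gt0// ltr1n.
by rewrite /growth_constant divr_ge0 ?mulr_ge0 ?addr_ge0 ?mulr_ge0 ?(ltW l2).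
Qed.

(** The logarithmic growth at the single ball [A], whose measure ratio to [B] is at most [K]. *)
Lemma near_part_bound (f : X -> U) (B A : set X) (S : R) : in_Lr mu r f ->
  BB B -> BB A -> hull mu BB B `<=` A -> m A <= K * m B -> 0 <= S ->
  (forall C, BB C -> B `<=` C ->
    Lr_bound mu r C (fun x => f x - mean mu f C) S) ->
  Lr_bound mu r A (cutoff (hull mu BB B) (fun x => f x - mean mu f B))
    (c1 * ln (1 + K) * S).
Proof.
move=> fL bB bA HA AK S0 hS; have [mA _] := ball_finite hBB bA.
have mB0 := ball_fine_gt0 hBB bB; have K1 := ball_K_ge1 hBB bB.
have K0 := le_trans ler01 K1; have c0 := growth_constant_ge0 bB.
have BA : B `<=` A by exact: subset_trans (ball_sub_hull hBB bB) HA.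
apply: Lr_bound_cutoff => //; first exact: measurable_hull hsep _.
  by apply: strongly_measurableD; [exact: fL.1|exact: strongly_measurable_cst].
apply: Lr_bound_le (Lr_bound_log r1 hBB hdoubling fL.1 bB S0 hS bA BA) => //.
  apply: mulr_ge0 (mulr_ge0 c0 _) S0.
  by rewrite ln_ge0// lerDl divr_ge0 ?fine_ge0.
apply: ler_wpM2r => //; apply: ler_wpM2l => //.
rewrite ler_ln ?posrE ?ltr_wpDr ?divr_ge0 ?fine_ge0//.
by rewrite lerD2l ler_pdivrMr.
Qed.

Lemma maximal_osc_bound (I : Type) (Tf : I -> (X -> U) -> X -> V)
    (T : (X -> U) -> X -> R) (L0 : R) (L1 : I -> R) (L : R) (f : X -> U)
    (B : set X) (S beta e1 e : R) :
  (forall a, R2 mu r (Tf a)) -> (forall a, R4 mu BB r (Tf a) (L1 a)) ->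
  (forall a, R5 mu BB (Tf a)) -> maximal_operator mu r Tf T ->
  T0 mu BB r (T : (X -> U) -> X -> R^o) L0 -> (forall a, L1 a <= L) ->
  in_Lr mu r f -> BB B -> 0 < beta < 1 -> 0 <= S ->
  (forall C, BB C -> B `<=` C ->
    Lr_bound mu r C (fun x => f x - mean mu f C) S) -> 0 < e1 -> 0 < e ->
  (OSC_beta mu beta B (T f : X -> R^o) <=
   (4 * K * (c1 * ln (1 + K)) * (1 - beta) `^ (- r^-1) * S * (L0 + e1)
    + L * (c1 * S) + e)%:E)%E.
Proof.
move=> r2 r4 r5 maxT t0 L1L fL bB /andP[b0 b1] S0 hS e10 e0.
set H := hull mu BB B; pose f1 := cutoff H (fun x => f x - mean mu f B).
pose f2 x := f x - f1 x; set bb := (1 - beta) `^ (- r^-1).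
have bb0 : 0 < bb by rewrite powR_gt0// subr_gt0.
have [mB Bfin] := ball_finite hBB bB; have mB0 := ball_fine_gt0 hBB bB.
have K1 := ball_K_ge1 hBB bB; have K0 := lt_le_trans ltr01 K1.
have [A [bA HA AK]] := ball_enlarge hBB bB.
have [mA Afin] := ball_finite hBB bA.
have Af : (mu A < +oo)%E by case/andP: Afin.
have mH : measurable H by exact: measurable_hull hsep _.
have Hfin : (mu H < +oo)%E.
  by apply: le_lt_trans Af; apply: le_measure; rewrite ?inE.
have f1L : in_Lr mu r f1 by exact: (in_Lr_cutoff_sub r1 _ mH Hfin fL).
have f2L : in_Lr mu r f2 := in_LrD r1 fL (in_LrN f1L).
have ff : (fun y => f1 y + f2 y) = f by apply/funext => y; rewrite addrC subrK.
have distT := maximal_operator_dist r1 maxT r2 f1L f2L; rewrite ff in distT.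
have w := near_part_bound fL bB bA HA AK S0 hS.
set n1 := c1 * ln (1 + K) * S in w.
have c0 := growth_constant_ge0 bB.
have n10 : 0 <= n1.
  by apply: mulr_ge0 (mulr_ge0 c0 _) S0; rewrite ln_ge0// lerDl ltW.
have L00 : 0 <= L0 by case: t0.
(* [bb] yields the factor [1 - beta] after raising to the power [r]; [2 * K] pays for the passage
   from mu(A) to mu(B) and for the half; [e1] keeps the level positive when [L0] is 0. *)
pose lam := 2 * (L0 + e1) * K * bb.
have lam0 : 0 < lam by rewrite !mulr_gt0// ltr_wpDl.
have [mTf1 _ _] := maxT _ f1L.
have Af1 : cutoff A f1 = f1.
  apply/funext => x; rewrite /f1 /cutoff !indicE.
  have [Hx|_] := boolP (x \in H); last by rewrite !scale0r scaler0.
  by rewrite (mem_set (HA x (set_mem Hx))) !scale1r.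
have exc := T0_exceptional r1 hBB t0 f1L mTf1 bA Af1 lam0 n10 w.
set Z := [set x | (lam * n1 < `|T f1 x|)%R] in exc.
have mZ : measurable Z by exact: measurable_norm_gt.
have ratio : (L0 / lam) `^ r * m A <= (1 - beta) / 2 * m B.
  have b'0 : 0 < 1 - beta by rewrite subr_gt0.
  have k2 : 0 < 2 * K by rewrite mulr_gt0.
  have lr : L0 / lam <= (2 * K)^-1 * bb^-1.
    rewrite ler_pdivrMr// (_ : _ * lam = L0 + e1) ?lerDl ?ltW// /lam.
    by field; rewrite !gt_eqF// ltr_wpDl.
  have : (L0 / lam) `^ r <= (2 * K)^-1 * (1 - beta).
    apply: (@le_trans _ _ (((2 * K)^-1 * bb^-1) `^ r)).
      apply: ge0_ler_powR lr; rewrite ?nnegrE; first exact: le_trans r1.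
        exact: divr_ge0 L00 (ltW lam0).
      by rewrite mulr_ge0 ?invr_ge0 ?(ltW k2) ?(ltW bb0).
    have -> : bb^-1 = (1 - beta) `^ r^-1 by rewrite /bb powRN invrK.
    rewrite powRM ?invr_ge0 ?powR_ge0 ?(ltW k2)//.
    rewrite -powRrM mulVf ?gt_eqF ?(lt_le_trans ltr01 r1)// powRr1 ?(ltW b'0)//.
    rewrite ler_wpM2r ?(ltW b'0)// ge1r_powR//.
    by rewrite invr_gt0 k2 invf_le1//=; lra.
  move=> h; apply: le_trans (ler_pM _ _ h AK) _; rewrite ?powR_ge0 ?fine_ge0//.
  rewrite (_ : _ * (K * m B) = (1 - beta) / 2 * m B)//.
  by field; rewrite !gt_eqF.
pose E := B `\` Z.
have muE : (beta%:E * mu B < mu E)%E.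
  have BA : B `<=` A := subset_trans (ball_sub_hull hBB bB) HA.
  have -> : mu E = (mu B - mu (B `&` Z))%E.
    by apply: measureD => //; case/andP: Bfin.
  have : (mu (B `&` Z) <= ((1 - beta) / 2 * m B)%:E)%E.
    apply: (@le_trans _ _ (mu (A `&` Z))).
      apply: le_measure; rewrite ?inE; try exact: measurableI.
      exact: setSI.
    by apply: le_trans exc _; rewrite lee_fin.
  rewrite -(ball_fineK hBB bB).
  have : mu (B `&` Z) \is a fin_num by apply: fin_num_setI => //; case/andP: Bfin.
  case: (mu (B `&` Z)) => // z _; rewrite lee_fin => hz.
  rewrite -EFinM -EFinB lte_fin.
  have : 0 < (1 - beta) * m B by rewrite mulr_gt0// subr_gt0.
  by lra.
have e20 : 0 < e / 2 by rewrite divr_gt0.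
have c'S a : ae_osc_le mu B (Tf a f2) (L * (c1 * S) + e / 2).
  have := far_part_osc r1 hBB hsep hdoubling (r2 a) (r4 a) (r5 a) fL bB S0 hS e20.
  apply: ae_osc_le_le; rewrite lerD2r; apply: ler_wpM2r => //.
  exact: mulr_ge0.
have muB0 : (0 < mu B)%E by case/andP: Bfin.
have osc2 := maximal_ae_osc_le maxT mB muB0 f2L c'S.
have [P aeP Pc] := osc2 _ e20.
apply: (@le_trans _ _ (OSC mu E (T f : X -> R^o))).
  apply: ereal_inf_lbound; exists E => //; split => //.
    exact: measurableD.
  exact: subDsetl.
apply: ae_osc_leP; exists (P `&` [set x | `|T f x - T f2 x| <= T f1 x]).
  exact: filterI.
move=> x y [Px /= fx] [Py /= fy] [Bx nZx] [By nZy].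
have := Pc x y Px Py Bx By => Pxy.
have Zle z : ~ Z z -> T f1 z <= lam * n1.
  by move=> nZ; rewrite (le_trans (ler_norm _))// leNgt; exact/negP.
have := Zle x nZx; have := Zle y nZy; have -> : lam * n1 =
    2 * K * (c1 * ln (1 + K)) * bb * S * (L0 + e1) by rewrite /lam /n1; ring.
move=> Zy Zx;
(* The path from [T f x] to [T f y] passes through [T f2 x] and [T f2 y]; its two end segments cost
   [lam * n1] each, whence the factor 4 in the bound. *)
rewrite (le_trans (ler_distD (T f2 x) _ _))//.
apply: le_trans (lerD (le_trans fx Zx) (ler_distD (T f2 y) _ _)) _.
rewrite [in X in _ + (_ + X)]distrC.
by move: Pxy (le_trans fy Zy); lra.
Qed.
End near_part.

Theorem theorem1p3 (R : realType) (K eta r : R) (hr : 1 <= r) :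
  exists2 c : R, 0 < c &
  forall (d : measure_display) (X : measurableType d)
         (mu : {measure set X -> \bar R}) (BB : set (set X))
         (U V : completeNormedModType R)
         (I : Type) (Tf : I -> (X -> U) -> X -> V) (T : (X -> U) -> X -> R)
         (L0 : R) (L1 : I -> R),
    ball_basis mu BB K -> separable_basis BB -> doubling_basis mu BB eta ->
    (forall a, BO_operator mu BB r (Tf a)) ->
    (forall a, R2 mu r (Tf a)) ->
    (forall a, R3 mu BB r (Tf a)) ->
    (forall a, R4 mu BB r (Tf a) (L1 a)) ->
    (forall a, R5 mu BB (Tf a)) ->
    maximal_operator mu r Tf T ->
    T0 mu BB r (T : (X -> U) -> X -> R^o) L0 ->
    (L0%:E + ereal_sup [set (L1 a)%:E | a in [set: I]] < +oo)%E ->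
    forall (f : X -> U) (B : set X) (beta : R),
      in_Lr mu r f -> BB B -> 0 < beta < 1 ->
      (OSC_beta mu beta B (T f : X -> R^o)
       <= c%:E * ((L0 * (1 - beta) `^ (- r^-1))%:E +
                  ereal_sup [set (L1 a)%:E | a in [set: I]])
          * mean_osc_sup mu BB r f B)%E.
Proof.
(* The constant is fixed before any ball-basis is given, so it has to be positive for arbitrary [K]
   and [eta]. Once a ball exists, both are at least 1 and the maxima disappear. *)
pose K' := Num.max 1 K; pose eta' := Num.max 1 eta.
pose c1 := growth_constant K' eta'.
have K'1 : 1 <= K' by rewrite le_max lexx.
have eta'1 : 1 <= eta' by rewrite le_max lexx.
have K'0 := lt_le_trans ltr01 K'1; have eta'0 := lt_le_trans ltr01 eta'1.
have c10 : 0 < c1.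
  have l2 : 0 < ln 2 :> R by rewrite ln_gt0// ltr1n.
  by rewrite divr_gt0// mulr_gt0// ltr_wpDr// !mulr_ge0 ?(ltW K'0) ?(ltW eta'0).
have ln0 : 0 <= ln (1 + K') by rewrite ln_ge0// lerDl ltW.
pose c2 := 4 * K' * (c1 * ln (1 + K')).
have c20 : 0 <= c2.
  by apply: mulr_ge0; apply: mulr_ge0 => //; exact: ltW.
exists (c2 + c1); first exact: ltr_wpDl.
move=> d X mu BB U V I Tf T L0 L1 hBB hsep hdoubling _ r2 _ r4 r5 maxT t0 fin.
move=> f B beta fL bB b01.
have [eta1 _] := hdoubling; have K1 := ball_K_ge1 hBB bB.
have EK : K' = K by rewrite /K' max_r.
have Eeta : eta' = eta by rewrite /eta' max_r// ltW.
have [S [S0 -> hS]] := mean_osc_sup_fin hr (ball_finite hBB) bB fL.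
have [mB Bfin] := ball_finite hBB bB.
have muB0 : (0 < mu B)%E by case/andP: Bfin.
(* An index is needed for the supremum of the [L1 a] to be nonnegative rather than - oo. *)
have [a0 _] := maximal_operator_inhabited maxT mB muB0 fL.
have L10 : (0 <= ereal_sup [set (L1 a)%:E | a in [set: I]])%E.
  apply: (@le_trans _ _ (L1 a0)%:E); last by apply: ereal_sup_ubound; exists a0.
  by rewrite lee_fin; case: (r4 a0).
have L1ub a : ((L1 a)%:E <= ereal_sup [set (L1 a)%:E | a in [set: I]])%E.
  by apply: ereal_sup_ubound; exists a.
move: (ereal_sup _) fin L10 L1ub => [L| |]//.
move=> _; rewrite lee_fin => L10 L1ub.
have L1L a : L1 a <= L by rewrite -lee_fin.
have L00 : 0 <= L0 by case: t0.
set bb := (1 - beta) `^ (- r^-1).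
have bb0 : 0 <= bb by exact: powR_ge0.
apply/lee_addgt0Pr => e e0.
rewrite [leRHS](_ : _ = ((c2 + c1) * (L0 * bb + L) * S + e)%:E)//.
(* The coefficient of [e1] in the near part; [D + 1] is a positive divisor even when [D] is 0. *)
pose D := c2 * bb * S.
have D0 : 0 <= D by exact: mulr_ge0 (mulr_ge0 c20 bb0) S0.
have D1 : 0 < D + 1 by exact: ltr_wpDl.
have e10 : 0 < e / 2 / (D + 1) by rewrite !divr_gt0.
have e20 : 0 < e / 2 by rewrite divr_gt0.
have := maximal_osc_bound hr hBB hsep hdoubling r2 r4 r5 maxT t0 L1L fL bB b01
  S0 hS e10 e20.
move=> /le_trans; apply; rewrite -EK -Eeta -/c1 -/c2 -/bb -/D lee_fin mulrDr.
have De : D * (e / 2 / (D + 1)) <= e / 2.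
  by rewrite mulrCA ler_piMr ?(ltW e20)// ler_pdivrMr// mul1r lerDl.
have x1 : 0 <= c1 * (L0 * bb) * S.
  exact: mulr_ge0 (mulr_ge0 (ltW c10) (mulr_ge0 L00 bb0)) S0.
have x2 : 0 <= c2 * L * S by exact: mulr_ge0 (mulr_ge0 c20 L10) S0.
have E1 : (c2 + c1) * (L0 * bb + L) * S =
  D * L0 + L * (c1 * S) + (c1 * (L0 * bb) * S + c2 * L * S) by rewrite /D; ring.
by rewrite E1; lra.
Qed.
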